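(* Let $\mathcal{A}=\mathcal{A}_n^{\bar q,\Lambda}(\mathbb{K})$ and $\mathcal{C}=\mathcal{A}_m^{\bar q',\Lambda'}(\mathbb{K})$ (generators $x'_i,y'_i$), with no $q_i$ and no $q'_i$ a root of unity. Then $\mathcal{A}[t]\cong\mathcal{C}[t]$ as $\mathbb{K}$-algebras if and only if $m=n$ and there exist a partition $\{1,\dots,n\}=P_1\cup P_2$ and a permutation $\sigma$ of $\{1,\dots,n\}$ such that: $q'_{\sigma(i)}=q_i$ for $i\in P_1$; $q'_{\sigma(i)}=q_i^{-1}$ for $i\in P_2$; $\lambda'_{\sigma(i)\sigma(j)}=\lambda_{ij}$ whenever $i,j$ lie in the same part; $\lambda'_{\sigma(j)\sigma(i)}=\lambda_{ij}$ whenever $i\in P_1,j\in P_2$. In that case, for any $\alpha_1,\dots,\alpha_n,a\in\mathbb{K}^*$ and $b\in\mathbb{K}$, an isomorphism $\varphi:\mathcal{A}[t]\to\mathcal{C}[t]$ is given by $\varphi(x_i)=\alpha_ix'_{\sigma(i)},\ \varphi(y_i)=\alpha_i^{-1}y'_{\sigma(i)}$ ($i\in P_1$), $\varphi(x_i)=\alpha_iy'_{\sigma(i)},\ \varphi(y_i)=-q_i^{-1}\alpha_i^{-1}x'_{\sigma(i)}$ ($i\in P_2$), $\varphi(t)=at+b$.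
   Context: For a field $\mathbb{K}$, $n\ge 1$, $\bar q=(q_1,\dots,q_n)\in(\mathbb{K}^* )^n$, and $\Lambda=(\lambda_{ij})$ an $n\times n$ matrix over $\mathbb{K}^*$ with $\lambda_{ij}=\lambda_{ji}^{-1}$, $\lambda_{ii}=1$, $\mathcal{A}_n^{\bar q,\Lambda}(\mathbb{K})$ is the $\mathbb{K}$-algebra generated by $x_1,y_1,\dots,x_n,y_n$ with relations: for $1\le i<j\le n$, $x_ix_j=\lambda_{ij}x_jx_i$, $y_jy_i=\lambda_{ji}y_iy_j$, $x_iy_j=\lambda_{ji}y_jx_i$, $x_jy_i=\lambda_{ij}y_ix_j$; and $x_iy_i-q_iy_ix_i=1$ for all $i$. $\mathcal{C}$ is defined likewise from $(m,\bar q',\Lambda')$. For an algebra $R$, $R[t]=R\otimes_{\mathbb{K}}\mathbb{K}[t]$. *)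

(* Defs.v *)
From HB Require Import structures.
From mathcomp Require Import all_boot all_order all_algebra.
Set Implicit Arguments. Unset Strict Implicit. Unset Printing Implicit Defensive.
Import Order.TTheory GRing.Theory Num.Theory.
Local Open Scope ring_scope.

Definition qparams (K : fieldType) (n : nat) (q : 'I_n -> K) (L : 'M[K]_n) : Prop :=
  (forall i, q i != 0) /\ (forall i j, L i j != 0) /\
  (forall i j, L i j = (L j i)^-1) /\ (forall i, L i i = 1).

Definition not_root_of_unity (K : fieldType) (c : K) : Prop :=
  forall k : nat, (0 < k)%N -> c ^+ k != 1.

Definition qweyl_rels (K : fieldType) (n : nat) (q : 'I_n -> K) (L : 'M[K]_n)
    (S : algType K) (x y : 'I_n -> S) : Prop :=
  (forall i j : 'I_n, (i < j)%N ->
      [/\ x i * x j = L i j *: (x j * x i),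
          y j * y i = L j i *: (y i * y j),
          x i * y j = L j i *: (y j * x i)
        & x j * y i = L i j *: (y i * x j)]) /\
  (forall i : 'I_n, x i * y i - q i *: (y i * x i) = 1).

(* (A, x, y) is (a model of) the K-algebra generated by the x_i, y_i subject to
   the relations above: universal property of the presentation. *)
Definition is_qweyl (K : fieldType) (n : nat) (q : 'I_n -> K) (L : 'M[K]_n)
    (A : algType K) (x y : 'I_n -> A) : Prop :=
  qweyl_rels q L x y /\
  forall (S : algType K) (u v : 'I_n -> S), qweyl_rels q L u v ->
    (exists f : {lrmorphism A -> S}, forall i, f (x i) = u i /\ f (y i) = v i) /\
    (forall f g : {lrmorphism A -> S},
        (forall i, f (x i) = g (x i) /\ f (y i) = g (y i)) -> f =1 g).

(* K-algebra homomorphisms between the polynomial algebras R[t] = R ⊗_K K[t],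
   realised as {poly R}; K acts on {poly R} through constants k%:A%:P. *)
Definition kalg_hom (K : fieldType) (A C : algType K)
    (f : {poly A} -> {poly C}) : Prop :=
  [/\ forall p p' : {poly A}, f (p + p') = f p + f p',
      forall p p' : {poly A}, f (p * p') = f p * f p',
      f 1 = 1
    & forall (k : K) (p : {poly A}), f ((k *: (1 : A))%:P * p) = (k *: (1 : C))%:P * f p].

Definition kalg_iso (K : fieldType) (A C : algType K)
    (f : {poly A} -> {poly C}) : Prop := kalg_hom f /\ bijective f.

(* The combinatorial condition of the theorem: partition {1..n} = P1 ∪ P2
   (P2 = complement of P1) and a bijection sigma. *)
Definition iso_data (K : fieldType) (n m : nat) (q : 'I_n -> K) (L : 'M[K]_n)
    (q' : 'I_m -> K) (L' : 'M[K]_m) (P1 : {set 'I_n}) (sigma : 'I_n -> 'I_m) : Prop :=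
  [/\ bijective sigma,
      forall i, i \in P1 -> q' (sigma i) = q i,
      forall i, i \notin P1 -> q' (sigma i) = (q i)^-1,
      forall i j, (i \in P1) = (j \in P1) -> L' (sigma i) (sigma j) = L i j
    & forall i j, i \in P1 -> j \notin P1 -> L' (sigma j) (sigma i) = L i j].

(* Main.v *)
(** The elements [z_i = x_i y_i - y_i x_i] satisfy [x_i z_i = q_i z_i x_i], and the algebra
    embeds in a quantum torus with generators [x_i^{+-1}, z_i^{+-1}] by
    [y_i = (q_i - 1)^-1 (z_i - 1) x_i^-1].  Exponents form the ordered group Z^2n, so elements
    of the torus have lowest and highest terms, which are multiplicative.  If [u] is normal
    ([uA] contained in [Au]) then [u x_i = b u] forces both extreme terms of [b] to be at
    [x_i], so [u] quasi-commutes with [x_i], and by symmetry with [y_i]; since no [q_i] is a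
    root of unity this makes [u] a scalar times a monomial in the [z_i].  In particular the
    centre is K, so A[t] ~ C[t] gives A ~ C; and an isomorphism A ~ C, acting on monomials in
    the z's, maps each [z_i] to a multiple of some [z'_(sigma i)].  Comparing lowest terms of
    the images of the [x_i] then yields the relations between the parameters. *)
Require Import Defs.
From HB Require Import structures.
From mathcomp Require Import all_boot all_order all_algebra.
From mathcomp Require Import boolp.
Set Implicit Arguments. Unset Strict Implicit. Unset Printing Implicit Defensive.
Import Order.TTheory GRing.Theory Num.Theory.
Local Open Scope ring_scope.

(** * Linear endomorphisms of the space of functions on an abelian group *)

Section LinearEndomorphisms.
Variables (K : fieldType) (G : zmodType).

(** [A] is known only through its universal property, so a concrete algebra that separates its
    elements has to be built. The quantum torus is realised inside the linear endomorphisms of the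
    functions [G -> K], a monomial being a shift by its exponent followed by multiplication with a
    character: associativity comes for free, and a coefficient is read off by applying the operator
    to a delta function. Faithfulness rests on two facts: ordered monomials in the y's and x's span
    [A], and their images have pairwise distinct highest exponents. Lowest and highest terms share
    one theory, stated for an arbitrary positive cone. The final argument uses lowest terms because
    the image of the algebra contains no negative exponent of a z, so lowest exponents that add up
    to zero must vanish there. That each z goes to a multiple of a single z comes from two mutually
    inverse matrices of exponents: they have entries in the natural numbers, hence are permutation
    matrices. *)

Record endo := Endo {
  efun : (G -> K) -> G -> K;
  efunP : forall a v w k,
    efun (fun g => a * v g + w g) k = a * efun v k + efun w k }.

Lemma endoP (s t : endo) : (forall w k, efun s w k = efun t w k) -> s = t.
Proof.
case: s t => [f fP] [g gP] /= fg.
have efg : f = g by apply/funext => w; apply/funext => k.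
by move: fP gP; rewrite efg => fP gP; rewrite (Prop_irrelevance fP gP).
Qed.

HB.instance Definition _ := gen_eqMixin endo.
HB.instance Definition _ := gen_choiceMixin endo.

Lemma endo0_subproof (a : K) (v w : G -> K) (k : G) : 0 = a * 0 + 0 :> K.
Proof. by rewrite mulr0 addr0. Qed.
Definition endo0 := @Endo (fun _ _ => 0) endo0_subproof.

Lemma endoN_subproof (s : endo) a v w k :
  - efun s (fun g => a * v g + w g) k = a * - efun s v k + - efun s w k.
Proof. by rewrite efunP opprD mulrN. Qed.
Definition endoN s := Endo (endoN_subproof s).

Lemma endoD_subproof (s t : endo) a v w k :
  efun s (fun g => a * v g + w g) k + efun t (fun g => a * v g + w g) k =
  a * (efun s v k + efun t v k) + (efun s w k + efun t w k).
Proof. by rewrite !efunP mulrDr addrACA. Qed.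
Definition endoD s t := Endo (endoD_subproof s t).

Lemma endoZ_subproof (c : K) (s : endo) a v w k :
  c * efun s (fun g => a * v g + w g) k = a * (c * efun s v k) + c * efun s w k.
Proof. by rewrite efunP mulrDr mulrCA. Qed.
Definition endoZ c s := Endo (endoZ_subproof c s).

Definition endo1 := @Endo (fun w => w) (fun _ _ _ _ => erefl).

Lemma endoM_subproof (s t : endo) a v w k :
  efun s (efun t (fun g => a * v g + w g)) k =
  a * efun s (efun t v) k + efun s (efun t w) k.
Proof.
rewrite -efunP; congr (efun s _ k); apply/funext => g; exact: efunP.
Qed.
Definition endoM s t := Endo (endoM_subproof s t).

Fact endo_addA : associative endoD.
Proof. by move=> r s t; apply: endoP => w k /=; rewrite addrA. Qed.
Fact endo_addC : commutative endoD.
Proof. by move=> s t; apply: endoP => w k /=; rewrite addrC. Qed.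
Fact endo_add0 : left_id endo0 endoD.
Proof. by move=> s; apply: endoP => w k /=; rewrite add0r. Qed.
Fact endo_addN : left_inverse endo0 endoN endoD.
Proof. by move=> s; apply: endoP => w k /=; rewrite addNr. Qed.
HB.instance Definition _ :=
  GRing.isZmodule.Build endo endo_addA endo_addC endo_add0 endo_addN.

Fact endo_mulA : associative endoM. Proof. by move=> r s t; apply: endoP. Qed.
Fact endo_mul1 : left_id endo1 endoM. Proof. by move=> s; apply: endoP. Qed.
Fact endo_1mul : right_id endo1 endoM. Proof. by move=> s; apply: endoP. Qed.
Fact endo_mulDl : left_distributive endoM +%R.
Proof. by move=> r s t; apply: endoP. Qed.
(** The reason for the field [efunP]: composition distributes over sums on its left for arbitrary
    maps, over sums on its right only for additive ones. *)
Fact endo_mulDr : right_distributive endoM +%R.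
Proof.
move=> r s t; apply: endoP => w k /=; rewrite -[efun r (efun s w) k]mul1r -efunP.
by congr (efun r _ k); apply/funext => g; rewrite mul1r.
Qed.
Fact endo_1neq0 : endo1 != 0.
Proof.
apply/eqP => /(congr1 (fun s => efun s (fun=> 1) 0)) /= /eqP.
by rewrite oner_eq0.
Qed.
HB.instance Definition _ := GRing.Zmodule_isNzRing.Build endo
  endo_mulA endo_mul1 endo_1mul endo_mulDl endo_mulDr endo_1neq0.

Fact endo_scaleA a b s : endoZ a (endoZ b s) = endoZ (a * b) s.
Proof. by apply: endoP => w k /=; rewrite mulrA. Qed.
Fact endo_scale1 : left_id 1 endoZ.
Proof. by move=> s; apply: endoP => w k /=; rewrite mul1r. Qed.
Fact endo_scaleDr : right_distributive endoZ +%R.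
Proof. by move=> a s t; apply: endoP => w k /=; rewrite mulrDr. Qed.
Fact endo_scaleDl s : {morph endoZ^~ s : a b / a + b}.
Proof. by move=> a b; apply: endoP => w k /=; rewrite mulrDl. Qed.
HB.instance Definition _ := GRing.Zmodule_isLmodule.Build K endo
  endo_scaleA endo_scale1 endo_scaleDr endo_scaleDl.

Fact endo_scaleAl (a : K) (s t : endo) : a *: (s * t) = a *: s * t.
Proof. by apply: endoP. Qed.
HB.instance Definition _ := GRing.Lmodule_isLalgebra.Build K endo endo_scaleAl.
Fact endo_scaleAr (a : K) (s t : endo) : a *: (s * t) = s * (a *: t).
Proof.
apply: endoP => w k /=.
have s0 : efun s (fun=> 0) k = 0.
  have := efunP s 1 (fun=> 0) (fun=> 0) k.
  rewrite (_ : (fun _ => _) = fun=> 0); last by apply/funext => g; rewrite mul1r addr0.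
  by rewrite mul1r -{1}[efun s _ k]addr0 => /addrI.
have := efunP s a (efun t w) (fun=> 0) k; rewrite s0 addr0 => <-.
by congr (efun s _ k); apply/funext => g; rewrite addr0.
Qed.
HB.instance Definition _ := GRing.Lalgebra_isAlgebra.Build K endo endo_scaleAr.

Lemma efun0 w k : efun 0 w k = 0. Proof. by []. Qed.

End LinearEndomorphisms.

(** * Finite linear combinations over a family of vectors *)

Section LinearCombinations.
Variables (K : fieldType) (V : lmodType K) (E : eqType) (b : E -> V).

(** The list may repeat an index, so that sums are concatenations; repetitions are merged in
    [spanned_collect]. *)
Definition spanned (Q : E -> Prop) (v : V) := exists s : seq (K * E),
  (forall p, p \in s -> Q p.2) /\ v = \sum_(p <- s) p.1 *: b p.2.

Lemma spanned0 Q : spanned Q 0.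
Proof. by exists [::]; rewrite big_nil. Qed.

Lemma spannedD Q v w : spanned Q v -> spanned Q w -> spanned Q (v + w).
Proof.
move=> [r [Qr ->]] [s [Qs ->]]; exists (r ++ s); rewrite big_cat; split=> // p.
by rewrite mem_cat => /orP[/Qr|/Qs].
Qed.

Lemma spanned_basis (Q : E -> Prop) c e : Q e -> spanned Q (c *: b e).
Proof.
by move=> Qe; exists [:: (c, e)]; rewrite big_seq1; split=> // p /[!inE] /eqP ->.
Qed.

Lemma spanned_sum Q (I : eqType) (r : seq I) (F : I -> V) :
  (forall i, i \in r -> spanned Q (F i)) -> spanned Q (\sum_(i <- r) F i).
Proof.
move=> QF; rewrite big_seq; elim/big_rec: _ => [|i t /QF Qi Qt].
  exact: spanned0.
exact: spannedD.
Qed.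

Lemma spannedZ Q c v : spanned Q v -> spanned Q (c *: v).
Proof.
move=> [s [Qs ->]]; rewrite scaler_sumr; apply: spanned_sum => p /Qs Qp.
by rewrite scalerA; apply: spanned_basis.
Qed.

Lemma spannedW (Q R : E -> Prop) v :
  (forall e, Q e -> R e) -> spanned Q v -> spanned R v.
Proof. by move=> QR [s [Qs ->]]; exists s; split=> // p /Qs /QR. Qed.

Lemma spanned_collect Q v : spanned Q v ->
  exists (s : seq E) (c : E -> K),
    [/\ uniq s, forall e, e \in s -> Q e & v = \sum_(e <- s) c e *: b e].
Proof.
move=> [s [Qs ->]]; exists (undup [seq p.2 | p <- s]).
exists (fun e => \sum_(p <- s) p.1 * (p.2 == e)%:R); split.
- exact: undup_uniq.
- by move=> e; rewrite mem_undup => /mapP[p /Qs Qp ->].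
under [RHS]eq_bigr => e _ do rewrite scaler_suml.
rewrite exchange_big /= big_seq [RHS]big_seq; apply: eq_bigr => p ps.
rewrite (bigD1_seq p.2) ?undup_uniq //=; last by rewrite mem_undup map_f.
rewrite eqxx mulr1 big1 ?addr0 // => e.
by rewrite eq_sym => /negPf ->; rewrite mulr0 scale0r.
Qed.

End LinearCombinations.

(** * The twisted group algebra of a bicharacter *)

Section TwistedMonomials.
Variables (K : fieldType) (G : zmodType) (chi : G -> G -> K).
Hypothesis chiDl : forall g h k, chi (g + h) k = chi g k * chi h k.
Hypothesis chiDr : forall g h k, chi g (h + k) = chi g h * chi g k.
Hypothesis chi_neq0 : forall g h, chi g h != 0.

Lemma chi0l g : chi 0 g = 1.
Proof. by apply: (mulfI (chi_neq0 0 g)); rewrite -chiDl addr0 mulr1. Qed.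

Lemma chi0r g : chi g 0 = 1.
Proof. by apply: (mulfI (chi_neq0 g 0)); rewrite -chiDr addr0 mulr1. Qed.

Lemma mono_subproof (h : G) a (v w : G -> K) k :
  chi k h * (a * v (k + h) + w (k + h)) =
  a * (chi k h * v (k + h)) + chi k h * w (k + h).
Proof. by rewrite mulrDr mulrCA. Qed.

(** The regular representation of the twisted group algebra: in a composite the second character is
    evaluated at [k + g], and the extra factor [chi g h] is the twist in [monoM]. *)
Definition mono h : endo K G := Endo (mono_subproof h).

Lemma monoM g h : mono g * mono h = chi g h *: mono (g + h).
Proof.
apply: endoP => w k /=.
by rewrite chiDl chiDr addrA !mulrA; congr (_ * _); rewrite mulrC !mulrA.
Qed.

Lemma mono0 : mono 0 = 1.
Proof. by apply: endoP => w k /=; rewrite chi0r mul1r addr0. Qed.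

(** Evaluation at 0 makes the character trivial, so on a combination of monomials this is the
    coefficient of [mono g]. *)
Definition tcoef (t : endo K G) g : K := efun t (fun k => (k == g)%:R) 0.
Arguments tcoef : simpl never.

Lemma tcoefD s t g : tcoef (s + t) g = tcoef s g + tcoef t g. Proof. by []. Qed.
Lemma tcoefZ a t g : tcoef (a *: t) g = a * tcoef t g. Proof. by []. Qed.
Lemma tcoef_sum (I : Type) (r : seq I) (F : I -> endo K G) g :
  tcoef (\sum_(i <- r) F i) g = \sum_(i <- r) tcoef (F i) g.
Proof. by elim/big_rec2: _ => // i _ t _ <-. Qed.
Lemma tcoef_mono h g : tcoef (mono h) g = (h == g)%:R.
Proof. by rewrite /tcoef /= chi0l mul1r add0r. Qed.

Lemma mono_neq0 g : mono g != 0.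
Proof.
apply/eqP => /(congr1 (tcoef^~ g)); rewrite tcoef_mono eqxx => /eqP.
by rewrite oner_eq0.
Qed.

Local Notation spanned := (spanned mono).

Lemma spannedM (Q : G -> Prop) s t :
    (forall g h, Q g -> Q h -> Q (g + h)) ->
  spanned Q s -> spanned Q t -> spanned Q (s * t).
Proof.
move=> QD [u [Qu ->]] [v [Qv ->]]; rewrite mulr_suml; apply: spanned_sum => p /Qu Qp.
rewrite mulr_sumr; apply: spanned_sum => r /Qv Qr.
by rewrite -scalerAl -scalerAr monoM !scalerA; apply/spanned_basis/QD.
Qed.

Lemma tcoef_spanned Q t g : spanned Q t -> tcoef t g != 0 -> Q g.
Proof.
move=> [s [Qs ->]]; rewrite tcoef_sum => /eqP; apply: contra_notP => nQg.
rewrite big_seq big1 // => p /Qs Qp; rewrite tcoefZ tcoef_mono.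
by case: eqP => [pg|_]; [case: nQg; rewrite -pg | rewrite mulr0].
Qed.

Lemma spanned_expand Q t : spanned Q t ->
  exists s : seq G, [/\ uniq s, forall g, g \in s -> Q g
                      & t = \sum_(g <- s) tcoef t g *: mono g].
Proof.
move=> /spanned_collect[s [c [us Qs ts]]]; exists s; split=> //.
rewrite {1}ts big_seq [RHS]big_seq; apply: eq_bigr => g gs; congr (_ *: _).
rewrite ts tcoef_sum (bigD1_seq g) //= tcoefZ tcoef_mono eqxx mulr1 big1 ?addr0 //.
by move=> h /negPf hg; rewrite tcoefZ tcoef_mono hg mulr0.
Qed.

(** Membership in the twisted group algebra, as a subset of all endomorphisms; there an operator is
    determined by its coefficients ([tcoef_eq]). *)
Definition finite_supp := spanned (fun _ => True).

Lemma finite_suppM s t : finite_supp s -> finite_supp t -> finite_supp (s * t).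
Proof. exact: spannedM. Qed.

Lemma finite_supp1 : finite_supp 1.
Proof. by rewrite -mono0 -[mono 0]scale1r; apply: spanned_basis. Qed.

Lemma finite_suppX t k : finite_supp t -> finite_supp (t ^+ k).
Proof.
by move=> ft; elim: k => [|k IH]; [apply: finite_supp1 | rewrite exprS; apply: finite_suppM].
Qed.

Lemma tcoef_eq s t : finite_supp s -> finite_supp t ->
  (forall g, tcoef s g = tcoef t g) -> s = t.
Proof.
move=> fs ft st; apply/eqP; rewrite -subr_eq0; apply/eqP.
have : finite_supp (s - t) by rewrite -scaleN1r; apply/spannedD/spannedZ.
move=> /spanned_expand[r [_ _ ->]]; rewrite big1 // => g _.
by rewrite tcoefD -scaleN1r tcoefZ mulN1r st subrr scale0r.
Qed.

Lemma tcoef_neq0 t : finite_supp t -> t != 0 -> exists g, tcoef t g != 0.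
Proof.
move=> ft t0; apply: contrapT => nt; move/eqP: t0; apply.
apply: tcoef_eq => //; first exact: spanned0.
by move=> g; apply/eqP; apply: contra_notT nt => ?; exists g.
Qed.

Lemma tcoefM s t : finite_supp s -> finite_supp t ->
  exists u v : seq G, [/\ uniq u, uniq v,
    forall g, g \notin u -> tcoef s g = 0, forall g, g \notin v -> tcoef t g = 0 &
    forall k, tcoef (s * t) k =
      \sum_(g <- u) \sum_(h <- v) tcoef s g * tcoef t h * chi g h * (g + h == k)%:R].
Proof.
move=> /spanned_expand[u [uu _ su]] /spanned_expand[v [uv _ tv]].
exists u, v; split=> //.
- move=> g gu; rewrite su tcoef_sum big_seq big1 // => h hu; rewrite tcoefZ tcoef_mono.
  by case: eqP hu => [->|]; rewrite ?(negPf gu) ?mulr0.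
- move=> g gu; rewrite tv tcoef_sum big_seq big1 // => h hu; rewrite tcoefZ tcoef_mono.
  by case: eqP hu => [->|]; rewrite ?(negPf gu) ?mulr0.
move=> k; rewrite {1}su {1}tv mulr_suml tcoef_sum; apply: eq_bigr => g _.
rewrite mulr_sumr tcoef_sum; apply: eq_bigr => h _.
by rewrite -scalerAl -scalerAr monoM !scalerA tcoefZ tcoef_mono.
Qed.

Lemma tcoefMmono t h g : finite_supp t -> tcoef (t * mono h) (g + h) = tcoef t g * chi g h.
Proof.
move=> /spanned_expand[u [_ _ ->]].
rewrite mulr_suml !tcoef_sum mulr_suml; apply: eq_bigr => k _.
rewrite -scalerAl monoM !tcoefZ !tcoef_mono (inj_eq (addIr h)) -!mulrA.
by case: eqP => [->|_]; rewrite ?(mulr0, mul0r, mulr1, mul1r).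
Qed.

Lemma tcoefmonoM t h g : finite_supp t -> tcoef (mono h * t) (h + g) = chi h g * tcoef t g.
Proof.
move=> /spanned_expand[u [_ _ ->]].
rewrite mulr_sumr !tcoef_sum mulr_sumr; apply: eq_bigr => k _.
rewrite -scalerAr monoM !tcoefZ !tcoef_mono (inj_eq (addrI h)).
by case: eqP => [->|_]; rewrite ?(mulr0, mul0r, mulr1, mul1r) // mulrC.
Qed.

(** Multiplication by [mono h] on either side translates all exponents by [h], so a
    quasi-commutation relation can be compared coefficient by coefficient and constrains every
    exponent of the support. *)
Lemma comm_mono_coef t h c g : finite_supp t ->
  t * mono h = c *: (mono h * t) -> tcoef t g != 0 -> chi g h = c * chi h g.
Proof.
move=> ft /(congr1 (tcoef^~ (g + h))); rewrite tcoefMmono // tcoefZ addrC tcoefmonoM //.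
by rewrite mulrA mulrC => e t0; apply: (mulIf t0).
Qed.

(** * Extreme terms with respect to a positive cone *)

Section LeadingTerm.
Variable pos : pred G.
Hypothesis pos0 : ~~ pos 0.
Hypothesis posD : forall g h, pos g -> pos h -> pos (g + h).
Hypothesis pos_total : forall g, g != 0 -> pos g || pos (- g).

(** The lowest exponent for the order with positive cone [pos]; for the opposite cone it is the
    highest one. *)
Definition lead (t : endo K G) g :=
  tcoef t g != 0 /\ forall h, tcoef t h != 0 -> h = g \/ pos (h - g).

Lemma pos_antisym g h : pos (g - h) -> ~~ pos (h - g).
Proof.
by move=> gh; apply/negP => /(posD gh); rewrite addrA subrK subrr (negPf pos0).
Qed.

Lemma lead_uniq t g h : lead t g -> lead t h -> g = h.
Proof.
move=> [tg leg] [th leh]; case: (leg _ th) => // hg; case: (leh _ tg) => // gh.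
by rewrite (negPf (pos_antisym hg)) in gh.
Qed.

Lemma pos_min (u : seq G) : u != [::] ->
  exists2 g, g \in u & forall h, h \in u -> h = g \/ pos (h - g).
Proof.
elim: u => [//|a u IH] _; have [->|/IH[g gu gP]] := eqVneq u [::].
  by exists a; rewrite ?mem_seq1 // => h /[!inE] /eqP ->; left.
have [ag|] := eqVneq a g.
  by exists g => [|h]; rewrite inE ?gu ?orbT // => /orP[/eqP ->|/gP //]; left.
rewrite -subr_eq0 => /pos_total/orP[pag|]; last rewrite opprB => pga.
  by exists g => [|h]; rewrite inE ?gu ?orbT // => /orP[/eqP ->|/gP //]; right.
exists a => [|h]; rewrite inE ?eqxx // => /orP[/eqP ->|hu]; first by left.
right; have [->|hg] // := gP _ hu.
by have := posD hg pga; rewrite addrA subrK.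
Qed.

Lemma lead_ex t : finite_supp t -> t != 0 -> exists g, lead t g.
Proof.
move=> ft t0; have [s [us _ ts]] := spanned_expand ft.
have supp g : tcoef t g != 0 -> g \in [seq g <- s | tcoef t g != 0].
  rewrite mem_filter => tg; rewrite tg; apply: contraR tg => gs.
  rewrite ts tcoef_sum big_seq big1 // => h hs.
  by rewrite tcoefZ tcoef_mono; case: (h =P g) hs gs => [-> ->|]; rewrite ?mulr0.
have [|g] := @pos_min [seq g <- s | tcoef t g != 0].
  by have [g /supp] := tcoef_neq0 ft t0; apply: contraTneq => ->.
by rewrite mem_filter => /andP[tg _] gP; exists g; split=> // h /supp /gP.
Qed.

(** Among the terms with nonzero coefficient, the one of lowest leading exponent cannot be
    cancelled: all the others live strictly above that exponent. *)
Lemma lead_free (E : eqType) (b : E -> endo K G) (gr : E -> G) (s : seq E) (c : E -> K) :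
    injective gr -> (forall e, lead (b e) (gr e)) -> uniq s ->
  \sum_(e <- s) c e *: b e = 0 -> forall e, e \in s -> c e = 0.
Proof.
move=> gr_inj leb us sum0 e0 e0s; apply/eqP; apply/negP => /negP c0.
have [|g] := @pos_min [seq gr e | e <- s & c e != 0].
  have : gr e0 \in [seq gr e | e <- s & c e != 0] by rewrite map_f // mem_filter c0.
  by apply: contraTneq => ->.
case/mapP => e /[!mem_filter] /andP[ce es] -> gP.
have := congr1 (tcoef^~ (gr e)) sum0; rewrite /= tcoef_sum (bigD1_seq e) //= tcoefZ.
rewrite big_seq_cond big1 => [|k /andP[ks ke]]; last first.
  rewrite tcoefZ; have [->|ck] := eqVneq (c k) 0; first by rewrite mul0r.
  apply/eqP; rewrite mulf_eq0 (negPf ck) /=; apply: contraT => bk.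
  have [/gr_inj ek|pek] := (leb k).2 _ bk; first by rewrite ek eqxx in ke.
  have [|/gr_inj ek|pke] := gP (gr k); first by rewrite map_f // mem_filter ck.
    by rewrite ek eqxx in ke.
  by rewrite (negPf (pos_antisym pek)) in pke.
by move/eqP; rewrite addr0 /tcoef efun0 mulf_eq0 (negPf ce) (negPf (leb e).1).
Qed.

(** The extreme exponent of a product arises from one pair only: if [a + b = g + h] with [a] above
    [g] and [b] above [h], then [a - g = h - b] would be positive together with its opposite. *)
Lemma tcoefM_lead s t g h : finite_supp s -> finite_supp t ->
  lead s g -> lead t h -> tcoef (s * t) (g + h) = tcoef s g * tcoef t h * chi g h.
Proof.
move=> fs ft [sg leg] [th leh].
have [u [v [uu uv su tv ->]]] := tcoefM fs ft.
rewrite (bigD1_seq g) //=; last by apply: contraR sg => /su ->.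
rewrite (bigD1_seq h) //=; last by apply: contraR th => /tv ->.
rewrite eqxx mulr1 [X in _ + X + _]big1 => [|b bh]; last first.
  by rewrite (inj_eq (addrI g)) (negPf bh) mulr0.
rewrite addr0 [X in _ + X]big1 ?addr0 // => a ag.
rewrite big1 // => b _; have [->|sa] := eqVneq (tcoef s a) 0; first by rewrite !mul0r.
have [->|tb] := eqVneq (tcoef t b) 0; first by rewrite mulr0 !mul0r.
case: eqP => [e|_]; last by rewrite mulr0.
have [eag|pag] := leg _ sa; first by rewrite eag eqxx in ag.
have eab : a - g = h - b by apply/eqP; rewrite subr_eq addrAC [h + g]addrC -e addrK.
have [ebh|pbh] := leh _ tb; first by rewrite eab ebh subrr (negPf pos0) in pag.
by rewrite eab (negPf (pos_antisym pbh)) in pag.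
Qed.

Lemma leadM s t g h : finite_supp s -> finite_supp t ->
  lead s g -> lead t h -> lead (s * t) (g + h).
Proof.
move=> fs ft ls lt; split.
  by rewrite (tcoefM_lead fs ft ls lt) !mulf_neq0 //; [case: ls | case: lt].
move=> k; have [u [v [uu uv su tv ->]]] := tcoefM fs ft.
case: ls lt => [sg leg] [th leh].
move=> /eqP; apply: contra_notP => nk; rewrite big1 // => a _; rewrite big1 // => b _.
have [->|sa] := eqVneq (tcoef s a) 0; first by rewrite !mul0r.
have [->|tb] := eqVneq (tcoef t b) 0; first by rewrite mulr0 !mul0r.
case: eqP => [e|_]; last by rewrite mulr0.
case: nk; rewrite -e opprD addrACA.
have [->|pa] := leg _ sa; have [->|pb] := leh _ tb; rewrite ?subrr ?add0r ?addr0; auto.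
Qed.

Lemma lead_mono c g : c != 0 -> lead (c *: mono g) g.
Proof.
move=> c0; split=> [|h]; rewrite tcoefZ tcoef_mono ?eqxx ?mulr1 //.
by case: (g =P h) => [->|]; [left | rewrite mulr0 eqxx].
Qed.

Lemma lead1 : lead 1 0.
Proof. by rewrite -mono0 -[mono 0]scale1r; apply/lead_mono/oner_neq0. Qed.

Lemma lead_prod (I : Type) (r : seq I) (F : I -> endo K G) (gr : I -> G) :
    (forall i, finite_supp (F i)) -> (forall i, lead (F i) (gr i)) ->
  lead (\prod_(i <- r) F i) (\sum_(i <- r) gr i).
Proof.
move=> fF lF; suff [] : finite_supp (\prod_(i <- r) F i) /\
  lead (\prod_(i <- r) F i) (\sum_(i <- r) gr i) by [].
elim: r => [|i r [fr lr]]; first by rewrite !big_nil; split; [apply: finite_supp1|apply: lead1].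
by rewrite !big_cons; split; [apply: finite_suppM | apply: leadM].
Qed.

Lemma leadX t g k : finite_supp t -> lead t g -> lead (t ^+ k) (g *+ k).
Proof.
move=> ft lt; elim: k => [|k IH]; first exact: lead1.
by rewrite exprS mulrS; apply: leadM => //; apply: finite_suppX.
Qed.

Lemma mul_finite_neq0 s t : finite_supp s -> finite_supp t ->
  s != 0 -> t != 0 -> s * t != 0.
Proof.
move=> fs ft /(lead_ex fs)[g ls] /(lead_ex ft)[h lt].
have [+ _] := leadM fs ft ls lt.
by apply: contra_neq => ->; rewrite /tcoef efun0.
Qed.

End LeadingTerm.

Section NormalTwistedMonomials.
Variable pos : pred G.
Hypothesis pos0 : ~~ pos 0.
Hypothesis posD : forall g h, pos g -> pos h -> pos (g + h).
Hypothesis pos_total : forall g, g != 0 -> pos g || pos (- g).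

Let neg g := pos (- g).

Lemma neg0 : ~~ neg 0. Proof. by rewrite /neg oppr0. Qed.
Lemma negD g h : neg g -> neg h -> neg (g + h).
Proof. by rewrite /neg opprD; apply: posD. Qed.
Lemma neg_total g : g != 0 -> neg g || neg (- g).
Proof. by rewrite /neg opprK orbC => /pos_total. Qed.

(* Both extreme terms of [a] sit at [h], since those of [u] can be cancelled. *)
Lemma mono_of_normal u a c h : finite_supp u -> finite_supp a -> u != 0 -> c != 0 ->
  u * (c *: mono h) = a * u -> exists b, a = b *: mono h.
Proof.
move=> fu fa u0 c0 e.
have fm : finite_supp (c *: mono h) by apply: spanned_basis.
have m0 : c *: mono h != 0 by rewrite scaler_eq0 negb_or c0 mono_neq0.
have a0 : a != 0.
  apply/eqP => a0; have := mul_finite_neq0 pos0 posD pos_total fu fm u0 m0.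
  by rewrite e a0 mul0r eqxx.
have low p : ~~ p 0 -> (forall g h, p g -> p h -> p (g + h)) ->
    (forall g, g != 0 -> p g || p (- g)) -> lead p a h.
  move=> p0 pD pt.
  have [g lu] := lead_ex pD pt fu u0; have [k la] := lead_ex pD pt fa a0.
  have := leadM p0 pD fu fm lu (lead_mono p h c0); rewrite e => l1.
  have := lead_uniq p0 pD l1 (leadM p0 pD fa fu la lu).
  by rewrite addrC => /addIr ->.
have [ah hP] := low pos pos0 posD pos_total; have [_ hN] := low neg neg0 negD neg_total.
exists (tcoef a h); apply: tcoef_eq => //; first exact: spanned_basis.
move=> g; rewrite tcoefZ tcoef_mono; case: eqVneq => [->|hg]; first by rewrite mulr1.
rewrite mulr0; apply/eqP; apply: contraNT hg => ag.
have [->//|pg] := hP _ ag; have [->//|] := hN _ ag.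
by rewrite /neg opprB (negPf (pos_antisym pos0 posD pg)).
Qed.

End NormalTwistedMonomials.

End TwistedMonomials.

(** * The lexicographic cone on integer vectors *)

Section LexicographicCone.
Variable I : finType.
Implicit Types g h : {ffun I -> int}.

(** The first nonzero coordinate is positive, with coordinates ordered by [enum_rank]. *)
Definition lexpos (g : {ffun I -> int}) := [exists i, (0 < g i) &&
  [forall j, (enum_rank j < enum_rank i)%N ==> (g j == 0)]].

Lemma lexposP g : reflect (exists2 i, 0 < g i &
  forall j, (enum_rank j < enum_rank i)%N -> g j = 0) (lexpos g).
Proof.
apply: (iffP existsP) => [[i /andP[gi /forallP gP]]|[i gi gP]].
  by exists i => // j ji; apply/eqP/(implyP (gP j)).
by exists i; rewrite gi; apply/forallP => j; apply/implyP => /gP ->.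
Qed.

Lemma lexpos0 : ~~ lexpos 0.
Proof. by apply/lexposP => -[i]; rewrite ffunE ltxx. Qed.

Lemma lexposD g h : lexpos g -> lexpos h -> lexpos (g + h).
Proof.
move=> /lexposP[i gi gP] /lexposP[j hj hP]; apply/lexposP.
case: (ltngtP (enum_rank i) (enum_rank j)) => [ij|ji|/val_inj/enum_rank_inj ij].
- exists i; first by rewrite ffunE hP // addr0.
  by move=> k ki; rewrite ffunE gP // hP // (ltn_trans ki).
- exists j; first by rewrite ffunE gP // add0r.
  by move=> k kj; rewrite ffunE hP // gP // (ltn_trans kj).
- exists i; first by rewrite ffunE addr_gt0 // ij.
  by move=> k ki; rewrite ffunE gP // hP // -ij.
Qed.

Lemma lexpos_total g : g != 0 -> lexpos g || lexpos (- g).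
Proof.
move=> g0; have [i gi] : exists i, g i != 0.
  apply/existsP; apply: contraNT g0 => /existsPn g0; apply/eqP/ffunP => i.
  by rewrite ffunE; apply/eqP; have := g0 i; rewrite negbK.
case: (@arg_minnP _ i (fun i => g i != 0) (fun i => enum_rank i) gi) => k gk kmin.
have gP j : (enum_rank j < enum_rank k)%N -> g j = 0.
  by move=> jk; apply/eqP; apply: contraTT jk => /kmin; rewrite -leqNgt.
case: (ltgtP (g k) 0) gk => // gk _; apply/orP; [right|left]; apply/lexposP.
  by exists k => [|j /gP]; rewrite ffunE ?oppr_gt0 // => ->; rewrite oppr0.
by exists k.
Qed.

End LexicographicCone.

(** * Bicharacters given by a matrix *)

Section Bicharacter.
Variables (K : fieldType) (I : finType) (M : I -> I -> K).
Hypothesis M_neq0 : forall i j, M i j != 0.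
Implicit Types g h k : {ffun I -> int}.

Definition bichar g h : K := \prod_i \prod_j M i j ^ (g i * h j).

Definition axis (i : I) (m : int) : {ffun I -> int} :=
  [ffun j => if j == i then m else 0].

Lemma axisE i m j : axis i m j = if j == i then m else 0.
Proof. by rewrite ffunE. Qed.

Lemma axisD i m p : axis i (m + p) = axis i m + axis i p.
Proof. by apply/ffunP => j; rewrite !ffunE; case: eqP. Qed.

Lemma axis0 i : axis i 0 = 0.
Proof. by apply/ffunP => j; rewrite !ffunE; case: eqP. Qed.

Lemma bicharDl g h k : bichar (g + h) k = bichar g k * bichar h k.
Proof.
rewrite /bichar -big_split; apply: eq_bigr => i _; rewrite -big_split /=.
by apply: eq_bigr => j _; rewrite ffunE mulrDl expfzDr.
Qed.

Lemma bicharDr g h k : bichar g (h + k) = bichar g h * bichar g k.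
Proof.
rewrite /bichar -big_split; apply: eq_bigr => i _; rewrite -big_split /=.
by apply: eq_bigr => j _; rewrite ffunE mulrDr expfzDr.
Qed.

Lemma bichar_neq0 g h : bichar g h != 0.
Proof.
by apply/prodf_neq0 => i _; apply/prodf_neq0 => j _; rewrite expfz_neq0.
Qed.

Lemma bichar_axisl i m g : bichar (axis i m) g = \prod_j M i j ^ (m * g j).
Proof.
rewrite /bichar (bigD1 i) //= [X in _ * X]big1 ?mulr1.
  by apply: eq_bigr => j _; rewrite axisE eqxx.
move=> j ji; rewrite big1 // => k _.
by rewrite axisE (negPf ji) mul0r expr0z.
Qed.

Lemma bichar_axisr g j m : bichar g (axis j m) = \prod_i M i j ^ (g i * m).
Proof.
apply: eq_bigr => i _; rewrite (bigD1 j) //= axisE eqxx big1 ?mulr1 //.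
by move=> k kj; rewrite axisE (negPf kj) mulr0 expr0z.
Qed.

Lemma bichar_axis i m j p : bichar (axis i m) (axis j p) = M i j ^ (m * p).
Proof.
rewrite bichar_axisl (bigD1 j) //= axisE eqxx big1 ?mulr1 //.
by move=> k kj; rewrite axisE (negPf kj) mulr0 expr0z.
Qed.

End Bicharacter.

(** * Algebra morphisms and induction on generators *)

Lemma lrmorphism_ex (K : fieldType) (A C : algType K) (f : A -> C) :
    (forall a b, f (a + b) = f a + f b) -> (forall a b, f (a * b) = f a * f b) ->
    f 1 = 1 -> (forall k a, f (k *: a) = k *: f a) ->
  exists F : {lrmorphism A -> C}, F =1 f.
Proof.
move=> fD fM f1 fZ.
have f0 : f 0 = 0 by rewrite -(scale0r 0) fZ scale0r.
pose m1 := GRing.isNmodMorphism.Build A C f (conj f0 fD).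
pose m2 := GRing.isMonoidMorphism.Build A C f (conj f1 fM).
pose m3 := GRing.isScalable.Build K A C *:%R f fZ.
pose F : {lrmorphism A -> C} := HB.pack f m1 m2 m3.
by exists F.
Qed.

Section Generation.
Variables (K : fieldType) (n : nat) (q : 'I_n -> K) (L : 'M[K]_n).
Variables (A : algType K) (x y : 'I_n -> A).
Hypothesis qwA : is_qweyl q L x y.

Section Induction.
Variable P : A -> Prop.
Hypothesis P1 : P 1.
Hypothesis PD : forall a b, P a -> P b -> P (a + b).
Hypothesis PZ : forall c a, P a -> P (c *: a).
Hypothesis PM : forall a b, P a -> P b -> P (a * b).
Hypothesis Px : forall i, P (x i).
Hypothesis Py : forall i, P (y i).

Definition gen_pred : {pred A} := fun a => `[< P a >].

Fact gen_pred_closed : GRing.subsemialg_closed gen_pred.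
Proof.
split; first exact/asboolP.
- split; last by move=> a b /asboolP Pa /asboolP Pb; apply/asboolP/PD.
  by apply/asboolP; rewrite -[0](scale0r 1); apply: PZ.
- by move=> c a /asboolP Pa; apply/asboolP/PZ.
- by move=> a b /asboolP Pa /asboolP Pb; apply/asboolP/PM.
Qed.

HB.instance Definition _ :=
  GRing.isSubalgClosed.Build K A gen_pred gen_pred_closed.

Record gen_sub := GenSub { gen_val :> A; _ : gen_val \in gen_pred }.
HB.instance Definition _ := [isSub for gen_val].
HB.instance Definition _ := [Choice of gen_sub by <:].
HB.instance Definition _ := [SubChoice_isSubAlgebra of gen_sub by <:].

(** The elements satisfying [P] form a subalgebra, and the universal property gives a morphism from
    [A] to it. Followed by the inclusion it fixes the generators, so by uniqueness it is the
    identity and every element lies in the subalgebra. *)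
Lemma qweyl_ind a : P a.
Proof.
have Px' i : x i \in gen_pred by apply/asboolP.
have Py' i : y i \in gen_pred by apply/asboolP.
pose u i : gen_sub := GenSub (Px' i).
pose v i : gen_sub := GenSub (Py' i).
have rel_uv : qweyl_rels q L u v.
  case: qwA => -[r1 r2] _; split=> [i j /r1[*]|i]; first by split; apply: val_inj.
  by apply: val_inj; apply: r2.
have [[f fP] _] := qwA.2 _ _ _ rel_uv.
have [_ uniqf] := qwA.2 _ _ _ qwA.1.
have [|||| F FE] := @lrmorphism_ex K A A (fun b => val (f b)).
- by move=> b c; rewrite rmorphD.
- by move=> b c; rewrite rmorphM.
- by rewrite rmorph1.
- by move=> k b; rewrite linearZ.
have [|||| J JE] := @lrmorphism_ex K A A id => //.
rewrite -[a]JE -(uniqf F J) ?FE; first exact/asboolP/(valP (f a)).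
by move=> i; rewrite !FE !JE; have [-> ->] := fP i.
Qed.

End Induction.
End Generation.

(** * Quasi-commuting elements *)

Definition qcomm (K : fieldType) (A : algType K) (c : K) (a b : A) :=
  a * b = c *: (b * a).

Section QuasiCommutation.
Variables (K : fieldType) (A : algType K).
Implicit Types (a b d : A) (c e : K).

Lemma qcommM c e a b d : qcomm c a b -> qcomm e a d -> qcomm (c * e) a (b * d).
Proof.
rewrite /qcomm => ab ad.
by rewrite mulrA ab -scalerAl -[b * a * d]mulrA ad -scalerAr scalerA [b * (d * a)]mulrA.
Qed.

Lemma qcommMl c e a b d : qcomm c a d -> qcomm e b d -> qcomm (c * e) (a * b) d.
Proof.
rewrite /qcomm => ad bd.
by rewrite -mulrA bd -scalerAr [a * (d * b)]mulrA ad -scalerAl scalerA [e * c]mulrC mulrA.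
Qed.

Lemma qcommD c a b d : qcomm c a b -> qcomm c a d -> qcomm c a (b + d).
Proof. by rewrite /qcomm mulrDr mulrDl scalerDr => -> ->. Qed.

Lemma qcommDl c a b d : qcomm c a d -> qcomm c b d -> qcomm c (a + b) d.
Proof. by rewrite /qcomm mulrDr mulrDl scalerDr => -> ->. Qed.

Lemma qcommZ c e a b : qcomm c a b -> qcomm c a (e *: b).
Proof. by rewrite /qcomm -scalerAr -scalerAl => ->; rewrite !scalerA mulrC. Qed.

Lemma qcommZl c e a b : qcomm c a b -> qcomm c (e *: a) b.
Proof. by rewrite /qcomm -scalerAr -scalerAl => ->; rewrite !scalerA mulrC. Qed.

Lemma qcommN c a b : qcomm c a b -> qcomm c a (- b).
Proof. by rewrite -scaleN1r; apply: qcommZ. Qed.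

Lemma qcommNl c a b : qcomm c a b -> qcomm c (- a) b.
Proof. by rewrite -scaleN1r; apply: qcommZl. Qed.

Lemma qcomm_sym c a b : c != 0 -> qcomm c a b -> qcomm c^-1 b a.
Proof. by rewrite /qcomm => c0 ->; rewrite scalerA mulVf // scale1r. Qed.

Lemma qcomm1 a : qcomm 1 a 1.
Proof. by rewrite /qcomm mulr1 mul1r scale1r. Qed.

Lemma qcomm1l a : qcomm 1 1 a.
Proof. by rewrite /qcomm mulr1 mul1r scale1r. Qed.

Lemma qcommX c a b k : qcomm c a b -> qcomm (c ^+ k) a (b ^+ k).
Proof.
move=> ab; elim: k => [|k IH]; first by rewrite !expr0; apply: qcomm1.
by rewrite !exprS; apply: qcommM.
Qed.

End QuasiCommutation.

(** * Consequences of the defining relations *)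

Section Relations.
Variables (K : fieldType) (n : nat) (q : 'I_n -> K) (L : 'M[K]_n).
Hypothesis qp : qparams q L.

Lemma qparamV i j : (L i j)^-1 = L j i.
Proof. by have [_ [_ [-> _]]] := qp; rewrite invrK. Qed.

Lemma qparam_neq0 i j : L i j != 0. Proof. by have [_ []] := qp. Qed.

Lemma qparam_q_neq0 i : q i != 0. Proof. by have [] := qp. Qed.

Lemma qparam_diag i : L i i = 1. Proof. by have [_ [_ []]] := qp. Qed.

(** The relations among the x's, and among the y's, with the indices exchanged are the inverted
    ones, as [L j i] is the inverse of [L i j]; the two mixed relations are one relation over all
    pairs of distinct indices. *)
Lemma qweyl_relsP (S : algType K) (x y : 'I_n -> S) : qweyl_rels q L x y <->
  [/\ forall i j, i != j -> qcomm (L i j) (x i) (x j),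
      forall i j, i != j -> qcomm (L i j) (y i) (y j),
      forall i j, i != j -> qcomm (L j i) (x i) (y j) &
      forall i, x i * y i - q i *: (y i * x i) = 1].
Proof.
split=> [[r1 r2]|[xx yy xy r2]]; last first.
  split=> // i j ij; have neq : i != j by rewrite -val_eqE ltn_eqF.
  have neq' := neq; rewrite eq_sym in neq'.
  by split; [apply: xx | apply: yy | apply: xy | apply: xy].
split=> // i j; rewrite -val_eqE neq_ltn => /orP[] /r1[xx yy xy yx] //.
- by rewrite -qparamV; apply: qcomm_sym xx; apply: qparam_neq0.
- by rewrite -qparamV; apply: qcomm_sym yy; apply: qparam_neq0.
Qed.

Section Elements.
Variables (S : algType K) (x y : 'I_n -> S).
Hypothesis rel : qweyl_rels q L x y.

Definition qz i := x i * y i - y i * x i.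

Let xx : forall i j, i != j -> qcomm (L i j) (x i) (x j).
Proof. by have [] := (qweyl_relsP x y).1 rel. Qed.
Let yy : forall i j, i != j -> qcomm (L i j) (y i) (y j).
Proof. by have [] := (qweyl_relsP x y).1 rel. Qed.
Let xy : forall i j, i != j -> qcomm (L j i) (x i) (y j).
Proof. by have [] := (qweyl_relsP x y).1 rel. Qed.
Let yx i j : i != j -> qcomm (L j i) (y i) (x j).
Proof.
move=> ij; rewrite -qparamV; apply: qcomm_sym; first exact: qparam_neq0.
by apply: xy; rewrite eq_sym.
Qed.

Lemma qxyE i : x i * y i = 1 + q i *: (y i * x i).
Proof. by have [_ /(_ i) <-] := rel; rewrite subrK. Qed.

Lemma qzE i : qz i = 1 + (q i - 1) *: (y i * x i).
Proof. by rewrite /qz qxyE scalerBl scale1r addrA. Qed.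

Lemma qz_xy i : (q i - 1) *: (x i * y i) = q i *: qz i - 1.
Proof.
rewrite qzE qxyE !scalerDr !scalerA [q i * _]mulrC addrAC; congr (_ + _).
by rewrite scalerBl scale1r.
Qed.

Lemma qcomm_xz_diag i : qcomm (q i) (x i) (qz i).
Proof.
rewrite /qcomm qzE mulrDr mulrDl mulr1 mul1r -scalerAr -scalerAl mulrA qxyE.
rewrite mulrDl mul1r -scalerAl !scalerDr !scalerA [q i * (q i - 1)]mulrC addrA.
by congr (_ + _); rewrite scalerBl scale1r addrC subrK.
Qed.

Lemma qcomm_zy_diag i : qcomm (q i) (qz i) (y i).
Proof.
rewrite /qcomm qzE mulrDr mulrDl mulr1 mul1r -scalerAr -scalerAl -mulrA qxyE.
rewrite mulrDr mulr1 -scalerAr !scalerDr !scalerA [q i * (q i - 1)]mulrC addrA.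
by congr (_ + _); rewrite scalerBl scale1r addrC subrK.
Qed.

(** The scalars picked up from [x j] and from [y j] are inverse to each other. *)
Lemma qcomm_xz i j : i != j -> qcomm 1 (x i) (qz j).
Proof.
move=> ij; rewrite /qz -(mulfV (qparam_neq0 i j)) qparamV.
apply: qcommD; first by apply: qcommM; [apply: xx | apply: xy].
by apply: qcommN; rewrite mulrC; apply: qcommM; [apply: xy | apply: xx].
Qed.

Lemma qcomm_yz i j : i != j -> qcomm 1 (y i) (qz j).
Proof.
move=> ij; rewrite /qz -(mulfV (qparam_neq0 j i)) qparamV.
apply: qcommD; first by apply: qcommM; [apply: yx | apply: yy].
by apply: qcommN; rewrite mulrC; apply: qcommM; [apply: yy | apply: yx].
Qed.

End Elements.

Definition qzmon (S : algType K) (x y : 'I_n -> S) (r : 'I_n -> nat) : S :=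
  \prod_i qz x y i ^+ r i.

End Relations.

(** * The quantum torus and the relations inside it *)

Section QuantumTorus.
Variables (K : fieldType) (n : nat) (q : 'I_n -> K) (L : 'M[K]_n).
Hypothesis qp : qparams q L.

(* The index [inl i] carries the exponent of z_i, [inr i] that of x_i. *)
Definition torus_matrix (a b : 'I_n + 'I_n) : K :=
  match a, b with
  | inr i, inr j => if (i < j)%N then L i j else 1
  | inr i, inl j => if i == j then q i else 1
  | inl _, _ => 1
  end.
Local Notation M := torus_matrix.

Lemma torus_matrix_neq0 a b : M a b != 0.
Proof.
case: a b => [i|i] [j|j] /=; rewrite ?oner_neq0 //; case: ifP => _; rewrite ?oner_neq0 //.
  exact: qparam_q_neq0 qp _.
exact: qparam_neq0 qp _ _.
Qed.

Definition tchi := bichar M.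
Definition tmono := mono tchi.

Lemma tchiDl g h k : tchi (g + h) k = tchi g k * tchi h k.
Proof. exact/bicharDl/torus_matrix_neq0. Qed.
Lemma tchiDr g h k : tchi g (h + k) = tchi g h * tchi g k.
Proof. exact/bicharDr/torus_matrix_neq0. Qed.
Lemma tchi_neq0 g h : tchi g h != 0.
Proof. exact/bichar_neq0/torus_matrix_neq0. Qed.

Lemma tmonoM g h : tmono g * tmono h = tchi g h *: tmono (g + h).
Proof. exact: monoM tchiDl tchiDr g h. Qed.

Lemma tmono0 : tmono 0 = 1.
Proof. exact: mono0 tchiDr tchi_neq0. Qed.

(** Commutation sees only the ratio [M a b / M b a]; hence each prescribed scalar sits on one side
    of the diagonal of [M], with 1 on the other. *)
Lemma tmono_axisC a m b p :
  qcomm ((M a b / M b a) ^ (m * p)) (tmono (axis a m)) (tmono (axis b p)).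
Proof.
rewrite /qcomm !tmonoM scalerA addrC; congr (_ *: _).
rewrite /tchi !bichar_axis // expfzMl [p * m]mulrC -mulrA -expfzMl.
by rewrite mulVf ?torus_matrix_neq0 // exp1rz mulr1.
Qed.

Definition tX i := tmono (axis (inr i) 1).
Definition tW i := tmono (axis (inr i) (- 1)).
Definition tZ i := tmono (axis (inl i) 1).
(** The solution of [z_i = 1 + (q_i - 1) y_i x_i] for [y_i] once [x_i] is invertible. *)
Definition tY i := (q i - 1)^-1 *: ((tZ i - 1) * tW i).

Lemma torus_matrix_rr i j : i != j -> M (inr i) (inr j) / M (inr j) (inr i) = L i j.
Proof.
rewrite -val_eqE neq_ltn /= => /orP[ij|ji]; rewrite ?ij ?ji ltnNge.
  by rewrite ltnW // divr1.
by rewrite ltnW //= div1r (qparamV qp).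
Qed.

Lemma tXX i j : i != j -> qcomm (L i j) (tX i) (tX j).
Proof. by move=> ij; have := tmono_axisC (inr i) 1 (inr j) 1; rewrite torus_matrix_rr. Qed.

Lemma tWW i j : i != j -> qcomm (L i j) (tW i) (tW j).
Proof.
by move=> ij; have := tmono_axisC (inr i) (-1) (inr j) (-1); rewrite torus_matrix_rr.
Qed.

Lemma tXW i j : i != j -> qcomm (L j i) (tX i) (tW j).
Proof.
move=> ij; have := tmono_axisC (inr i) 1 (inr j) (-1).
by rewrite torus_matrix_rr // mul1r exprN1 (qparamV qp).
Qed.

Lemma tXZ i j : qcomm (if i == j then q i else 1) (tX i) (tZ j).
Proof. by have := tmono_axisC (inr i) 1 (inl j) 1; rewrite /= divr1 mul1r expr1z. Qed.

Lemma tWZ i j : i != j -> qcomm 1 (tW i) (tZ j).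
Proof.
move=> ij; have := tmono_axisC (inr i) (-1) (inl j) 1.
by rewrite /= (negPf ij) divr1 exp1rz.
Qed.

Lemma tZZ i j : qcomm 1 (tZ i) (tZ j).
Proof. by have := tmono_axisC (inl i) 1 (inl j) 1; rewrite /= divr1 exp1rz. Qed.

Lemma tXWK i : tX i * tW i = 1.
Proof.
rewrite tmonoM -axisD subrr axis0 tmono0 /tchi bichar_axis // /= ltnn exp1rz.
by rewrite scale1r.
Qed.

Lemma tWXK i : tW i * tX i = 1.
Proof.
rewrite tmonoM -axisD addNr axis0 tmono0 /tchi bichar_axis // /= ltnn exp1rz.
by rewrite scale1r.
Qed.

Hypothesis q_neq1 : forall i, q i != 1.

Lemma torus_rels : qweyl_rels q L tX tY.
Proof.
have XZ1 i j : i != j -> qcomm 1 (tX i) (tZ j - 1).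
  move=> ij; apply: qcommD; last exact/qcommN/qcomm1.
  by have := tXZ i j; rewrite (negPf ij).
have WZ1 i j : i != j -> qcomm 1 (tW i) (tZ j - 1).
  by move=> ij; apply: qcommD; [apply: tWZ | apply/qcommN/qcomm1].
have ZZ1 i j : qcomm 1 (tZ i - 1) (tZ j - 1).
  apply: qcommDl; last exact/qcommNl/qcomm1l.
  by apply: qcommD; [apply: tZZ | apply/qcommN/qcomm1].
have ZW1 i j : i != j -> qcomm 1 (tZ i - 1) (tW j).
  by move=> ij; rewrite -invr1; apply/qcomm_sym/WZ1; rewrite ?oner_neq0 // eq_sym.
apply/(qweyl_relsP qp); split.
- exact: tXX.
- move=> i j ij; apply/qcommZ/qcommZl; rewrite -[L i j]mul1r.
  apply: qcommMl; first by rewrite -[1]mulr1; apply: qcommM; [apply: ZZ1|apply: ZW1].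
  by rewrite -[L i j]mul1r; apply: qcommM; [apply: WZ1 | apply: tWW].
- move=> i j ij; apply: qcommZ; rewrite -[L j i]mul1r.
  by apply: qcommM; [apply: XZ1 | apply: tXW].
move=> i; have q1 : q i - 1 != 0 by rewrite subr_eq0.
have XZ : tX i * tZ i = q i *: (tZ i * tX i) by have := tXZ i i; rewrite eqxx.
rewrite /tY -scalerAr -scalerAl -mulrA tWXK mulr1 mulrA mulrBr XZ mulr1 mulrBl.
rewrite -scalerAl -mulrA tXWK mulr1 scalerA mulrC -scalerA -scalerBr.
rewrite [q i *: (_ - 1)]scalerBr opprB [X in _ *: X]addrC addrA subrK.
by rewrite -[X in _ *: (_ - X)]scale1r -scalerBl scalerA mulVf // scale1r.
Qed.

Lemma torus_qz i : qz tX tY i = tZ i.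
Proof.
have q1 : q i - 1 != 0 by rewrite subr_eq0.
rewrite (qzE torus_rels) /tY -scalerAl scalerA mulfV // scale1r -mulrA tWXK mulr1.
by rewrite addrC subrK.
Qed.

End QuantumTorus.

(** * Ordered monomials span the algebra *)

Section PBW.
Variables (K : fieldType) (n : nat) (q : 'I_n -> K) (L : 'M[K]_n).
Hypothesis qp : qparams q L.
Variables (A : algType K) (x y : 'I_n -> A).
Hypothesis qwA : is_qweyl q L x y.
Local Notation expo := ({ffun 'I_n -> nat} * {ffun 'I_n -> nat})%type.

Definition pbw (e : expo) : A := \prod_i (y i ^+ e.1 i * x i ^+ e.2 i).

Let rel : qweyl_rels q L x y := qwA.1.

(** Opens an ordered product at position [i]. The element [a] collects the factors before [i], so
    whatever quasi-commutes with the other factors can be carried to that place and absorbed in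
    [u]. *)
Lemma prod_isolate (f : 'I_n -> A) (i : 'I_n) : exists a b,
  (forall u, \prod_j (if j == i then u else f j) = a * u * b) /\
  (forall t, (forall j, j != i -> exists c, qcomm c t (f j)) -> exists c, qcomm c t a).
Proof.
have := index_enum_uniq 'I_n; case/splitPr: (mem_index_enum i) => s1 s2.
rewrite cat_uniq /= negb_or -!andbA => /and5P[_ is1 _ is2 _].
exists (\prod_(j <- s1) f j), (\prod_(j <- s2) f j); split=> [u|t].
  rewrite big_cat big_cons /= eqxx mulrA; congr (_ * _ * _); apply: eq_big_seq => j js.
    by case: eqP js is1 => // ->; case: (i \in s1).
  by case: eqP js is2 => // ->; case: (i \in s2).
move=> qt; elim: s1 is1 => [|j s1 IH].
  by exists 1; rewrite big_nil; apply: qcomm1.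
rewrite inE negb_or eq_sym => /andP[/qt[c qc] /IH[d qd]].
by exists (c * d); rewrite big_cons; apply: qcommM.
Qed.

(** The lower term stems from the 1 in [x_i y_i = 1 + q_i y_i x_i]. *)
Lemma x_yX i k : exists a b, x i * y i ^+ k.+1 = a *: (y i ^+ k.+1 * x i) + b *: y i ^+ k.
Proof.
elim: k => [|k [a [b IH]]].
  by exists (q i), 1; rewrite expr1 expr0 scale1r (qxyE rel) addrC.
exists (a * q i), (a + b); rewrite exprSr mulrA IH mulrDl -!scalerAl -exprSr.
rewrite -mulrA (qxyE rel) mulrDr mulr1 -scalerAr scalerDr scalerA scalerDl.
by rewrite mulrA -!exprSr [RHS]addrCA addrA.
Qed.

Let ins (e : {ffun 'I_n -> nat}) (i : 'I_n) (k : nat) : {ffun 'I_n -> nat} :=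
  [ffun j => if j == i then k else e j].

Lemma pbw_isolate (e : expo) i : exists a b,
  (forall k l, pbw (ins e.1 i k, ins e.2 i l) = a * (y i ^+ k * x i ^+ l) * b) /\
  (forall t, (forall j, j != i -> exists c, qcomm c t (y j ^+ e.1 j * x j ^+ e.2 j)) ->
    exists c, qcomm c t a).
Proof.
have [a [b [ab tP]]] := prod_isolate (fun j => y j ^+ e.1 j * x j ^+ e.2 j) i.
exists a, b; split=> // k l; rewrite -ab; apply: eq_bigr => j _.
by rewrite !ffunE; case: eqP => [->|].
Qed.

Lemma ins_id e i : ins e i (e i) = e.
Proof. by apply/ffunP => j; rewrite ffunE; case: eqP => [->|]. Qed.

Local Notation pspan := (spanned pbw (fun _ => True)).

Lemma pspan_xM i a : pspan a -> pspan (x i * a).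
Proof.
move=> [s [_ ->]]; rewrite mulr_sumr; apply: spanned_sum => -[c0 e] _ /=.
rewrite -scalerAr; apply: spannedZ.
have [p [r [pr tP]]] := pbw_isolate e i.
have [j ji|c xp] := tP (x i).
  have [rx _ ry _] := (qweyl_relsP qp x y).1 rel; rewrite eq_sym in ji.
  exists (L j i ^+ e.1 j * L i j ^+ e.2 j).
  by apply: qcommM; apply: qcommX; [apply: ry | apply: rx].
have -> : pbw e = p * (y i ^+ e.1 i * x i ^+ e.2 i) * r.
  by rewrite -pr !ins_id; case: (e).
rewrite !mulrA xp -!scalerAl -!mulrA; apply: spannedZ; rewrite !mulrA -(mulrA p).
case: (e.1 i) => [|k].
  rewrite expr0 mulr1 -(mulrA p) -exprS -[x i ^+ _]mul1r -(expr0 (y i)) -pr.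
  by rewrite -[pbw _]scale1r; apply: spanned_basis.
have [u [v ->]] := x_yX i k; rewrite mulrDr !mulrDl -!scalerAr -!scalerAl.
apply: spannedD; apply: spannedZ.
  rewrite -(mulrA p) -(mulrA (_ ^+ _)) -exprS -pr.
  by rewrite -[pbw _]scale1r; apply: spanned_basis.
by rewrite -(mulrA p) -pr -[pbw _]scale1r; apply: spanned_basis.
Qed.

Lemma pspan_yM i a : pspan a -> pspan (y i * a).
Proof.
move=> [s [_ ->]]; rewrite mulr_sumr; apply: spanned_sum => -[c0 e] _ /=.
rewrite -scalerAr; apply: spannedZ.
have [p [r [pr tP]]] := pbw_isolate e i.
have [j ji|c yp] := tP (y i).
  have [_ ry rx _] := (qweyl_relsP qp x y).1 rel.
  exists (L i j ^+ e.1 j * (L i j)^-1 ^+ e.2 j).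
  apply: qcommM; apply: qcommX; first by apply: ry; rewrite eq_sym.
  by apply: qcomm_sym; [apply: qparam_neq0 qp _ _ | apply: rx].
have -> : pbw e = p * (y i ^+ e.1 i * x i ^+ e.2 i) * r.
  by rewrite -pr !ins_id; case: (e).
rewrite !mulrA yp -!scalerAl; apply: spannedZ.
rewrite -(mulrA p) -exprS -(mulrA p) -pr.
by rewrite -[pbw _]scale1r; apply: spanned_basis.
Qed.

(** The span contains 1 and is stable under left multiplication by the generators; induction on the
    left factor makes it stable under all of [A]. *)
Lemma pbw_span a : pspan a.
Proof.
have p1 : pspan 1.
  have -> : 1 = pbw ([ffun=> 0%N], [ffun=> 0%N]).
    by rewrite /pbw big1 // => i _; rewrite !ffunE !expr0 mulr1.
  by rewrite -[pbw _]scale1r; apply: spanned_basis.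
suff : forall b, pspan b -> pspan (a * b) by move=> /(_ _ p1); rewrite mulr1.
move: a; apply: (qweyl_ind qwA) => [b|a b Pa Pb d Pd|c a Pa b Pb|a b Pa Pb d Pd|i|i].
- by rewrite mul1r.
- by rewrite mulrDl; apply: spannedD; [apply: Pa | apply: Pb].
- by rewrite -scalerAl; apply/spannedZ/Pa.
- by rewrite -mulrA; apply/Pa/Pb.
- exact: pspan_xM.
- exact: pspan_yM.
Qed.

End PBW.

(** * Faithfulness of the embedding into the torus *)

Section Embedding.
Variables (K : fieldType) (n : nat) (q : 'I_n -> K) (L : 'M[K]_n).
Hypothesis qp : qparams q L.
Hypothesis q_nr : forall i, not_root_of_unity (q i).
Variables (A : algType K) (x y : 'I_n -> A).
Hypothesis qwA : is_qweyl q L x y.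

Local Notation G := {ffun 'I_n + 'I_n -> int}.
Local Notation tmono := (tmono q L).
Local Notation tchi := (tchi q L).
Let chiDl := tchiDl qp.
Let chiDr := tchiDr qp.
Let chi_neq0 := tchi_neq0 qp.

Lemma q_neq1 i : q i != 1.
Proof. by have := q_nr i (ltn0Sn 0); rewrite expr1. Qed.

Lemma q_exp_eq1 i (k : int) : q i ^ k = 1 -> k = 0.
Proof.
case: k => [[//|k]|k] /eqP.
  by rewrite (negPf (q_nr i _)).
by rewrite NegzE -exprnN invr_eq1 (negPf (q_nr i _)).
Qed.

Lemma q_exp_inj i (k l : int) : q i ^ k = q i ^ l -> k = l.
Proof.
have q0 := qparam_q_neq0 qp i.
move=> e; apply/eqP; rewrite -subr_eq0; apply/eqP/(@q_exp_eq1 i).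
by rewrite expfzDr // e -expfzDr // subrr expr0z.
Qed.

Lemma torus_hom : exists f : {lrmorphism A -> endo K G},
  forall i, f (x i) = tX q L i /\ f (y i) = tY q L i.
Proof. exact: (qwA.2 _ _ _ (torus_rels qp q_neq1)).1. Qed.

Variable rho : {lrmorphism A -> endo K G}.
Hypothesis rhoE : forall i, rho (x i) = tX q L i /\ rho (y i) = tY q L i.

Lemma rho_qz i : rho (qz x y i) = tZ q L i.
Proof.
by rewrite /qz rmorphB !rmorphM /=; have [-> ->] := rhoE i; apply: (torus_qz qp q_neq1).
Qed.

Definition zpos (g : G) := forall i, 0 <= g (inl i).

Lemma zposD g h : zpos g -> zpos h -> zpos (g + h).
Proof. by move=> pg ph i; rewrite ffunE addr_ge0. Qed.

Lemma tYE i : tY q L i = (q i - 1)^-1 *: tmono (axis (inl i) 1 + axis (inr i) (-1))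
  - (q i - 1)^-1 *: tmono (axis (inr i) (-1)).
Proof.
rewrite /tY mulrBl mul1r scalerBr /tZ /tW (tmonoM qp); congr (_ *: _ - _).
rewrite -[RHS]scale1r; congr (_ *: _).
by rewrite /tchi bichar_axis //= exp1rz.
Qed.

(** Only the x's get inverted: the two terms of [tY] contain [z_i] to the powers 1 and 0, so no
    generator brings in a negative exponent of a z. *)
Lemma rho_span a : spanned tmono zpos (rho a).
Proof.
move: a; apply: (qweyl_ind qwA) => [|a b Pa Pb|c a Pa|a b Pa Pb|i|i].
- rewrite rmorph1 -(tmono0 qp) -[X in spanned _ _ X]scale1r.
  by apply: spanned_basis => i; rewrite ffunE.
- by rewrite rmorphD; apply: spannedD.
- by rewrite linearZ; apply: spannedZ.
- by rewrite rmorphM; apply: (spannedM chiDl chiDr zposD).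
- have [-> _] := rhoE i; rewrite -[tX _ _ _]scale1r.
  by apply: spanned_basis => j; rewrite axisE.
have [_ ->] := rhoE i; rewrite tYE -scaleNr; apply: spannedD.
  by apply: spanned_basis => j; rewrite ffunE !axisE /=; case: eqP.
by apply: spanned_basis => j; rewrite axisE.
Qed.

Lemma rho_finite a : finite_supp tchi (rho a).
Proof. exact: spannedW (rho_span a). Qed.

Lemma rho_zpos a g : tcoef (rho a) g != 0 -> zpos g.
Proof. exact: (tcoef_spanned chiDl chi_neq0 (rho_span a)). Qed.

Let neg (g : G) := lexpos (- g).
Let neg0 : ~~ neg 0 := neg0 (@lexpos0 _).
Let negD := negD (@lexposD ('I_n + 'I_n)%type).
Let neg_total := neg_total (@lexpos_total ('I_n + 'I_n)%type).

Lemma lexpos_axis (i : 'I_n + 'I_n) : lexpos (axis i 1).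
Proof.
apply/lexposP; exists i; first by rewrite axisE eqxx.
by move=> j; rewrite axisE; case: eqP => // ->; rewrite ltnn.
Qed.

Lemma toplead_x i : lead neg (rho (x i)) (axis (inr i) 1).
Proof.
have [-> _] := rhoE i; rewrite -[tX _ _ _]scale1r.
exact: (lead_mono chiDl chi_neq0 _ _ (oner_neq0 K)).
Qed.

(** Of [z_i x_i^-1] and [x_i^-1] the first is higher, since the exponents differ by the unit vector
    at [z_i]. *)
Lemma toplead_y i : lead neg (rho (y i)) (axis (inl i) 1 + axis (inr i) (-1)).
Proof.
have [_ ->] := rhoE i; rewrite tYE; have q1 : q i - 1 != 0.
  by rewrite subr_eq0 q_neq1.
have zx : axis (inr i) (-1) != axis (inl i) 1 + axis (inr i) (-1) :> G.
  by apply/eqP => /ffunP/(_ (inl i)); rewrite !ffunE /= eqxx.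
split=> [|h]; rewrite -scaleNr tcoefD !tcoefZ !(tcoef_mono chiDl chi_neq0) ?eqxx.
  by rewrite (negPf zx) mulr0 addr0 mulr1 invr_neq0.
case: (_ =P h) => [<- _|_]; first by left.
rewrite mulr0 add0r; case: (_ =P h) => [<- _|_]; last by rewrite mulr0 eqxx.
by right; rewrite /neg opprB addrK lexpos_axis.
Qed.

(** The highest exponent of the image of [pbw x y e]; both components of [e] can be read off from
    it, which is what makes [rho] injective. *)
Definition topdeg (e : {ffun 'I_n -> nat} * {ffun 'I_n -> nat}) : G :=
  \sum_i ((axis (inl i) 1 + axis (inr i) (-1)) *+ e.1 i + axis (inr i) 1 *+ e.2 i).

Lemma topdeg_inl e i : topdeg e (inl i) = (e.1 i)%:Z.
Proof.
rewrite /topdeg sum_ffunE (bigD1 i) //= big1 ?addr0; last first.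
  move=> j; rewrite eq_sym => /negPf ij; rewrite !(ffunE, ffunMnE) /=.
  by rewrite (_ : (inl i == inl j) = false) ?addr0 ?mul0rn.
by rewrite !(ffunE, ffunMnE) /= eqxx addr0 mul0rn addr0 natz.
Qed.

Lemma topdeg_inr e i : topdeg e (inr i) = (e.2 i)%:Z - (e.1 i)%:Z.
Proof.
rewrite /topdeg sum_ffunE (bigD1 i) //= big1 ?addr0; last first.
  move=> j; rewrite eq_sym => /negPf ij; rewrite !(ffunE, ffunMnE) /=.
  by rewrite (_ : (inr i == inr j) = false) ?addr0 ?mul0rn.
by rewrite !(ffunE, ffunMnE) /= eqxx add0r mulNrn !natz addrC.
Qed.

Lemma topdeg_inj : injective topdeg.
Proof.
move=> e f ef; have e1 i : e.1 i = f.1 i.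
  by have := congr1 (fun g : G => g (inl i)) ef; rewrite /= !topdeg_inl => -[].
have e2 i : e.2 i = f.2 i.
  have := congr1 (fun g : G => g (inr i)) ef; rewrite /= !topdeg_inr e1.
  by move/addIr => -[].
by case: e f e1 e2 {ef} => [a b] [c d] /= /ffunP -> /ffunP ->.
Qed.

Lemma rho_inj a : rho a = 0 -> a = 0.
Proof.
have [s [c [us _ ->]]] := spanned_collect (pbw_span qp qwA a).
rewrite linear_sum /= => s0; rewrite big_seq big1 // => e es.
suff -> : c e = 0 by rewrite scale0r.
have lp e' : lead neg (rho (pbw x y e')) (topdeg e').
  rewrite rmorph_prod /=; apply: (lead_prod chiDl chiDr chi_neq0 neg0 negD).
    by move=> i; apply: rho_finite.
  move=> i; rewrite rmorphM !rmorphXn.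
  apply: (leadM chiDl chiDr chi_neq0 neg0 negD).
  - by apply: (finite_suppX chiDl chiDr chi_neq0); apply: rho_finite.
  - by apply: (finite_suppX chiDl chiDr chi_neq0); apply: rho_finite.
  - by apply: (leadX chiDl chiDr chi_neq0 neg0 negD); [apply: rho_finite | apply: toplead_y].
  - by apply: (leadX chiDl chiDr chi_neq0 neg0 negD); [apply: rho_finite | apply: toplead_x].
apply: (lead_free neg0 negD neg_total topdeg_inj lp us _ es).
by rewrite -[RHS]s0; apply: eq_bigr => f _; rewrite linearZ.
Qed.

End Embedding.

(** * Exchanging the x's and the y's *)

Section Swap.
Variables (K : fieldType) (n : nat) (q : 'I_n -> K) (L : 'M[K]_n).
Hypothesis qp : qparams q L.

Lemma qparams_swap : qparams (fun i => (q i)^-1) L.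
Proof. by have [q0 LP] := qp; split=> // i; rewrite invr_neq0. Qed.

Lemma not_root_of_unityV (c : K) : not_root_of_unity c -> not_root_of_unity c^-1.
Proof. by move=> cP k k0; rewrite exprVn invr_eq1 cP. Qed.

(** With [u = y_i] and [v = - q_i x_i] one finds [u v - q_i^-1 v u = x_i y_i - q_i y_i x_i], so the
    exchange inverts [q] and keeps [L]. It transfers results on the x's to the y's, and it accounts
    for the constant [- q_i^-1] in the isomorphism on P2. *)
Lemma is_qweyl_swap (A : algType K) (x y : 'I_n -> A) : is_qweyl q L x y ->
  is_qweyl (fun i => (q i)^-1) L y (fun i => - q i *: x i).
Proof.
have q0 := qparam_q_neq0 qp; case=> rel univ; split.
  have [xx yy xy r2] := (qweyl_relsP qp x y).1 rel; apply/(qweyl_relsP qparams_swap).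
  split=> // [i j ij|i j ij|i].
  - exact/qcommZ/qcommZl/xx.
  - apply: qcommZ; rewrite -(qparamV qp); apply: qcomm_sym; first exact: qparam_neq0 qp _ _.
    by apply: xy; rewrite eq_sym.
  - rewrite -scalerAr -scalerAl scalerA mulrN mulVf // scaleN1r opprK addrC scaleNr.
    exact: r2.
move=> S u v relS; have [|[f fE] funiq] := univ S (fun i => - (q i)^-1 *: v i) u.
  have [uu vv uv r2] := (qweyl_relsP qparams_swap u v).1 relS; apply/(qweyl_relsP qp).
  split=> // [i j ij|i j ij|i].
  - exact/qcommZ/qcommZl/vv.
  - apply: qcommZl; rewrite -(qparamV qp); apply: qcomm_sym; first exact: qparam_neq0 qp _ _.
    by apply: uv; rewrite eq_sym.
  - rewrite -scalerAr -scalerAl scalerA mulrN mulfV // scaleN1r opprK addrC scaleNr.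
    exact: r2.
split.
  exists f => i; have [fx fy] := fE i; rewrite fy linearZ /= fx scalerA mulrNN.
  by rewrite mulfV // scale1r.
move=> g h gh; apply: funiq => i; have [gy gx] := gh i; split=> //.
move: gx; rewrite !linearZ => /(congr1 (fun t => - (q i)^-1 *: t)).
by rewrite !scalerA mulrNN mulVf // !scale1r.
Qed.

End Swap.

(** * Normal elements and the centre *)

Definition normal_elt (K : fieldType) (A : algType K) (u : A) :=
  forall a, exists b, u * a = b * u.

Section NormalQuasiCommutes.
Variables (K : fieldType) (n : nat) (q : 'I_n -> K) (L : 'M[K]_n).
Hypothesis qp : qparams q L.
Hypothesis q_nr : forall i, not_root_of_unity (q i).
Variables (A : algType K) (x y : 'I_n -> A).
Hypothesis qwA : is_qweyl q L x y.

Local Notation I := ('I_n + 'I_n)%type.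
Let chiDl := tchiDl qp.
Let chiDr := tchiDr qp.
Let chi_neq0 := tchi_neq0 qp.

Lemma normal_qcomm_x u i : u != 0 -> normal_elt u -> exists c, qcomm c u (x i).
Proof.
move=> u0 /(_ (x i))[b ub]; have [rho rhoE] := torus_hom qp q_nr qwA.
have rfin := rho_finite qp qwA rhoE; have rinj := rho_inj qp q_nr qwA rhoE.
have [||c rb] := mono_of_normal chiDl chiDr chi_neq0 (@lexpos0 I) (@lexposD I)
    (@lexpos_total I) (rfin u) (rfin b) _ (oner_neq0 K) (h := axis (inr i) 1).
- by apply: contra_neq u0 => /rinj.
- by rewrite scale1r; have [rx _] := rhoE i; rewrite -[mono _ _]rx -!rmorphM ub.
exists c; rewrite /qcomm ub scalerAl; congr (_ * _); apply/eqP; rewrite -subr_eq0.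
apply/eqP/rinj; rewrite linearB linearZ /= rb; have [-> _] := rhoE i.
exact: subrr.
Qed.

End NormalQuasiCommutes.

Section NormalElements.
Variables (K : fieldType) (n : nat) (q : 'I_n -> K) (L : 'M[K]_n).
Hypothesis qp : qparams q L.
Hypothesis q_nr : forall i, not_root_of_unity (q i).
Variables (A : algType K) (x y : 'I_n -> A).
Hypothesis qwA : is_qweyl q L x y.

Local Notation I := ('I_n + 'I_n)%type.
Local Notation G := {ffun I -> int}.
Implicit Types g h : G.
Local Notation tmono := (tmono q L).
Local Notation tchi := (tchi q L).
Let chiDl := tchiDl qp.
Let chiDr := tchiDr qp.
Let chi_neq0 := tchi_neq0 qp.

Lemma normal_qcomm_y u i : u != 0 -> normal_elt u -> exists c, qcomm c u (y i).
Proof.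
exact: (normal_qcomm_x (qparams_swap qp) (fun i => not_root_of_unityV (q_nr i))
          (is_qweyl_swap qp qwA)).
Qed.

(* The two scalars are inverse to each other because [u] commutes with 1. *)
Lemma normal_qcomm_z u i : u != 0 -> normal_elt u -> qcomm 1 u (qz x y i).
Proof.
move=> u0 nu; have [c ux] := normal_qcomm_x qp q_nr qwA i u0 nu.
have [d uy] := normal_qcomm_y i u0 nu.
have uxy := qcommM ux uy; have uyx := qcommM uy ux; rewrite mulrC in uyx.
suff cd : c * d = 1 by rewrite -cd; apply: qcommD => //; apply: qcommN.
have := qcommD uxy (qcommN (qcommZ (q i) uyx)); have [_ /(_ i) ->] := qwA.1.
rewrite /qcomm mulr1 mul1r => /eqP; rewrite -subr_eq0 -{1}[u]scale1r -scalerBl.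
by rewrite scaler_eq0 (negPf u0) orbF subr_eq0 => /eqP.
Qed.

(** The [a] for which [z_i a] lies in [A z_i] form a subalgebra, and [z_i] quasi-commutes with every
    generator. *)
Lemma qz_normal i : normal_elt (qz x y i).
Proof.
have rel := qwA.1; have q0 := qparam_q_neq0 qp i.
apply: (qweyl_ind qwA) => [|a b [a' za] [b' zb]|c a [a' za]|a b [a' za] [b' zb]|j|j].
- by exists 1; rewrite mulr1 mul1r.
- by exists (a' + b'); rewrite mulrDr za zb -mulrDl.
- by exists (c *: a'); rewrite -scalerAl -scalerAr za.
- by exists (a' * b'); rewrite mulrA za -mulrA zb mulrA.
- have [->|ji] := eqVneq j i.
    exists ((q i)^-1 *: x i); rewrite -scalerAl.
    by have := qcomm_sym q0 (qcomm_xz_diag rel i).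
  exists (x j); have := qcomm_sym (oner_neq0 K) (qcomm_xz qp rel ji).
  by rewrite /qcomm invr1 scale1r.
have [->|ji] := eqVneq j i.
  by exists (q i *: y i); rewrite -scalerAl; apply: (qcomm_zy_diag rel).
exists (y j); have := qcomm_sym (oner_neq0 K) (qcomm_yz qp rel ji).
by rewrite /qcomm invr1 scale1r.
Qed.

Lemma tchi_zr g i : tchi g (axis (inl i) 1) = q i ^ g (inr i).
Proof.
rewrite /tchi bichar_axisr big_sumType /= big1 ?mul1r => [|j _]; last by rewrite exp1rz.
rewrite (bigD1 i) //= eqxx mulr1 big1 ?mulr1 // => j /negPf ->.
by rewrite exp1rz.
Qed.

Lemma tchi_zl i g : tchi (axis (inl i) 1) g = 1.
Proof. by rewrite /tchi bichar_axisl big1 // => j _; rewrite exp1rz. Qed.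

(** [tchi] is 1 with [z_i] on the left and a power of [q i] with [z_i] on the right:
    quasi-commutation with [z_i] detects the exponent of [x_i]. *)
Lemma tsupp_z t g i c : finite_supp tchi t -> qcomm c t (tZ q L i) ->
  tcoef t g != 0 -> q i ^ g (inr i) = c.
Proof.
move=> ft tz /(comm_mono_coef chiDl chiDr chi_neq0 ft tz).
by rewrite tchi_zr tchi_zl mulr1.
Qed.

Lemma tchi_xl i g : (forall j, g (inr j) = 0) ->
  tchi (axis (inr i) 1) g = q i ^ g (inl i).
Proof.
move=> g0; rewrite /tchi bichar_axisl big_sumType /= [X in _ * X]big1 ?mulr1 => [|j _].
  rewrite (bigD1 i) //= eqxx mul1r big1 ?mulr1 // => j.
  by rewrite eq_sym => /negPf ->; rewrite exp1rz.
by rewrite g0 mulr0 expr0z.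
Qed.

Lemma tchi0l g h : (forall j, g (inr j) = 0) -> tchi g h = 1.
Proof.
move=> g0; rewrite /tchi /bichar big_sumType /= !big1 ?mulr1 // => j _.
  by rewrite big1 // => k _; rewrite g0 mul0r expr0z.
by rewrite big1 // => k _; rewrite exp1rz.
Qed.

Lemma tmonoM0 g h : (forall j, g (inr j) = 0) -> tmono g * tmono h = tmono (g + h).
Proof. by move=> g0; rewrite (tmonoM qp) tchi0l // scale1r. Qed.

Lemma tmonoX0 g k : (forall j, g (inr j) = 0) -> tmono g ^+ k = tmono (g *+ k).
Proof.
move=> g0; elim: k => [|k IH]; first by rewrite (tmono0 qp).
by rewrite exprS IH tmonoM0 // mulrS.
Qed.

Definition zdeg (r : 'I_n -> nat) : G := \sum_i axis (inl i) (r i)%:Z.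

Lemma zdeg_inl r i : zdeg r (inl i) = (r i)%:Z.
Proof.
rewrite /zdeg sum_ffunE (bigD1 i) //= axisE eqxx big1 ?addr0 // => j ji.
by rewrite axisE (_ : (inl i == inl j) = false) //; apply: negbTE; rewrite eq_sym.
Qed.

Lemma zdeg_inr r i : zdeg r (inr i) = 0.
Proof. by rewrite /zdeg sum_ffunE big1 // => j _; rewrite axisE. Qed.

Variable rho : {lrmorphism A -> endo K G}.
Hypothesis rhoE : forall i, rho (x i) = tX q L i /\ rho (y i) = tY q L i.
Let rfin := rho_finite qp qwA rhoE.
Let rinj := rho_inj qp q_nr qwA rhoE.

Lemma rho_qzX i k : rho (qz x y i ^+ k) = tmono (axis (inl i) k%:Z).
Proof.
elim: k => [|k IH]; first by rewrite rmorph1 axis0 (tmono0 qp).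
rewrite exprS rmorphM /= IH (rho_qz qp q_nr rhoE) tmonoM0 => [|j]; last by rewrite axisE.
by rewrite -axisD.
Qed.

Lemma rho_qzmon r : rho (qzmon x y r) = tmono (zdeg r).
Proof.
rewrite /qzmon rmorph_prod /zdeg; suff prodE : forall s : seq 'I_n,
    \prod_(i <- s) rho (qz x y i ^+ r i) = tmono (\sum_(i <- s) axis (inl i) (r i)%:Z)
    /\ forall j, (\sum_(i <- s) axis (inl i) (r i)%:Z : G) (inr j) = 0.
  by have [] := prodE (index_enum 'I_n).
elim=> [|i s [IH IH0]]; first by rewrite !big_nil (tmono0 qp); split=> // j; rewrite ffunE.
rewrite !big_cons IH rho_qzX tmonoM0 => [|j]; last by rewrite axisE.
by split=> // j; rewrite ffunE IH0 axisE.
Qed.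

Lemma supp_qcomm_z u g i : qcomm 1 u (qz x y i) -> tcoef (rho u) g != 0 -> g (inr i) = 0.
Proof.
move=> uz ug; apply: (q_exp_eq1 q_nr (i := i)); apply: tsupp_z (rfin u) _ ug.
by have := congr1 rho uz; rewrite linearZ !rmorphM /= (rho_qz qp q_nr rhoE).
Qed.

(** Commuting with all z's removes the x's from the support; what is left passes [x_i] at the cost
    of [q i] to the exponent of [z_i], so the common scalar [c] fixes that exponent. *)
Lemma supp_qcomm_x u g i c : (forall j, qcomm 1 u (qz x y j)) -> qcomm c u (x i) ->
  tcoef (rho u) g != 0 -> c * q i ^ g (inl i) = 1.
Proof.
move=> uz ux ug; have g0 j := supp_qcomm_z (uz j) ug.
have := congr1 rho ux; rewrite linearZ !rmorphM /=; have [-> _] := rhoE i => e.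
have := comm_mono_coef chiDl chiDr chi_neq0 (rfin u) e ug.
by rewrite tchi0l // tchi_xl.
Qed.

Lemma rho_mono_eq u g : (forall h, tcoef (rho u) h != 0 -> h = g) ->
  rho u = tcoef (rho u) g *: tmono g.
Proof.
move=> ug; apply: (tcoef_eq chiDl chi_neq0 (rfin u)); first exact: spanned_basis.
move=> h; rewrite tcoefZ (tcoef_mono chiDl chi_neq0).
case: eqVneq => [->|gh]; first by rewrite mulr1.
by rewrite mulr0; apply/eqP; apply: contraNT gh => /ug ->.
Qed.

Lemma rho_inj_eq a b : rho a = rho b -> a = b.
Proof.
by move=> ab; apply/eqP; rewrite -subr_eq0; apply/eqP/rinj; rewrite linearB /= ab subrr.
Qed.

Lemma normal_qzmon u : u != 0 -> normal_elt u ->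
  exists c r, c != 0 /\ u = c *: qzmon x y r.
Proof.
move=> u0 nu; have uz j := normal_qcomm_z j u0 nu.
have ru0 : rho u != 0 by apply: contra_neq u0 => /rinj.
have [g ug] := tcoef_neq0 chiDl chi_neq0 (rfin u) ru0.
(* Any exponent [g] of the support serves, as it turns out to be the only one. The absolute values
   change nothing, because exponents of z's in the image of [rho] are nonnegative. *)
exists (tcoef (rho u) g), (fun i => `|g (inl i)|%N); split=> //; apply: rho_inj_eq.
rewrite linearZ /= rho_qzmon.
have -> : zdeg (fun i => `|g (inl i)|%N) = g.
  apply/ffunP => -[i|i]; last by rewrite zdeg_inr (supp_qcomm_z (uz i) ug).
  by rewrite zdeg_inl gez0_abs // (rho_zpos qp qwA rhoE ug).
apply: rho_mono_eq => h uh; apply/ffunP => -[i|i]; last first.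
  by rewrite (supp_qcomm_z (uz i) ug) (supp_qcomm_z (uz i) uh).
have [c ux] := normal_qcomm_x qp q_nr qwA i u0 nu.
apply: (q_exp_inj qp q_nr (i := i)).
have eh := supp_qcomm_x uz ux uh; have eg := supp_qcomm_x uz ux ug.
have c0 : c != 0 by apply/eqP => c0; move/eqP: eg; rewrite c0 mul0r eq_sym oner_eq0.
by apply: (mulfI c0); rewrite eh eg.
Qed.

(** Central elements quasi-commute with scalar 1, which forces the exponents of the x's and then
    those of the z's to vanish. *)
Lemma qweyl_center (u : A) : (forall a, u * a = a * u) -> exists c : K, u = c%:A.
Proof.
move=> uC; have uz j : qcomm 1 u (qz x y j) by rewrite /qcomm scale1r.
have [->|u0] := eqVneq u 0; first by exists 0; rewrite scale0r.
exists (tcoef (rho u) 0); apply: rho_inj_eq; rewrite linearZ rmorph1 /= -(tmono0 qp).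
apply: rho_mono_eq => h uh; apply/ffunP => -[i|i]; rewrite ffunE; last first.
  exact: supp_qcomm_z (uz i) uh.
have ux : qcomm 1 u (x i) by rewrite /qcomm scale1r.
by apply: (q_exp_eq1 q_nr (i := i)); have := supp_qcomm_x uz ux uh; rewrite mul1r.
Qed.

End NormalElements.

(** * Polynomial algebras: evaluation, cancellation, extension *)

Section PolynomialHomomorphisms.
Variable K : fieldType.

Lemma alg_comm (A : algType K) (k : K) (a : A) : k%:A * a = a * k%:A.
Proof. by rewrite mulr_algl mulr_algr. Qed.

(** Over noncommutative coefficients evaluation is multiplicative at central points; this is why all
    evaluations below are at scalars. *)
Lemma horner_algM (A : algType K) (p r : {poly A}) (k : K) :
  (p * r).[k%:A] = p.[k%:A] * r.[k%:A].
Proof. by rewrite hornerM_comm // /comm_poly alg_comm. Qed.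

Lemma polyCZ (A : algType K) (k : K) (a : A) : (k *: a)%:P = k%:A%:P * a%:P.
Proof. by rewrite -polyCM mulr_algl. Qed.

Lemma kalg_homB (A C : algType K) (F : {poly A} -> {poly C}) p r :
  kalg_hom F -> F (p - r) = F p - F r.
Proof. by case=> FD _ _ _; apply/eqP; rewrite eq_sym subr_eq -FD subrK. Qed.

Lemma kalg_hom_alg (A C : algType K) (F : {poly A} -> {poly C}) k :
  kalg_hom F -> F k%:A%:P = k%:A%:P.
Proof. by case=> _ _ F1 FZ; rewrite -[k%:A%:P]mulr1 FZ F1 mulr1. Qed.

Lemma kalg_hom_inv (A C : algType K) (F : {poly A} -> {poly C}) H :
  kalg_hom F -> cancel F H -> cancel H F -> kalg_hom H.
Proof.
case=> FD FM F1 FZ FK HK; have Finj := can_inj FK.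
split=> [p r|p r||k p]; apply: Finj.
- by rewrite FD !HK.
- by rewrite FM !HK.
- by rewrite F1 HK.
- by rewrite FZ !HK.
Qed.

Lemma kalg_hom_eval (A C : algType K) (F : {poly A} -> {poly C}) (k : K) :
  kalg_hom F -> exists f : {lrmorphism A -> C}, forall a, f a = (F a%:P).[k%:A].
Proof.
case=> FD FM F1 FZ.
have [||||f fE] := @lrmorphism_ex K A C (fun a => (F a%:P).[k%:A]).
- by move=> a b; rewrite polyCD FD hornerD.
- by move=> a b; rewrite polyCM FM horner_algM.
- by rewrite F1 hornerC.
- by move=> c a; rewrite polyCZ FZ horner_algM hornerC mulr_algl.
by exists f.
Qed.

(** [p - p(l)] is a multiple of [t - l], whose image under [F] vanishes at [k]; so evaluation at [k]
    after [F] factors through evaluation at [l]. *)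
Lemma kalg_hom_evalE (A C : algType K) (F : {poly A} -> {poly C}) (k l : K) p :
  kalg_hom F -> (F 'X).[k%:A] = l%:A -> (F p).[k%:A] = (F p.[l%:A]%:P).[k%:A].
Proof.
move=> hF Fx; have : root (p - p.[l%:A]%:P) l%:A by rewrite /root !hornerE subrr.
case/factor_theorem => r pr; have [FD FM _ _] := hF.
rewrite -{1}[p](subrK p.[l%:A]%:P) FD hornerD pr FM horner_algM kalg_homB //.
by rewrite kalg_hom_alg // hornerD hornerN Fx hornerC subrr mulr0 add0r.
Qed.

(* If both centres are K then phi(t) evaluates to a scalar [k] at 0, and reduction
   modulo t on one side matches reduction modulo t - k on the other. *)
Lemma poly_cancellation (A C : algType K) (phi : {poly A} -> {poly C}) :
    (forall u : A, (forall a, u * a = a * u) -> exists c : K, u = c%:A) ->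
    (forall u : C, (forall a, u * a = a * u) -> exists c : K, u = c%:A) ->
    kalg_iso phi ->
  exists (f : {lrmorphism A -> C}) (g : {lrmorphism C -> A}), cancel f g /\ cancel g f.
Proof.
move=> ZA ZC [hphi [psi phiK psiK]]; have hpsi := kalg_hom_inv hphi phiK psiK.
(* As [t] is central and [phi] is onto, [phi t] commutes with all constants, so its value at 0 is
   central in [C]. *)
have [k phik] : exists k : K, (phi 'X).[0%:A] = k%:A.
  apply: ZC => c; have [_ phiM _ _] := hphi.
  have := congr1 phi (commr_polyX (psi c%:P)); rewrite !phiM psiK.
  by move/(congr1 (fun p => p.[0%:A])); rewrite !horner_algM hornerC.
have psik : (psi 'X).[k%:A] = 0%:A.
  have [l psil] : exists l : K, (psi 'X).[k%:A] = l%:A.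
    apply: ZA => a; have [_ psiM _ _] := hpsi.
    have := congr1 psi (commr_polyX (phi a%:P)); rewrite !psiM phiK.
    by move/(congr1 (fun p => p.[k%:A])); rewrite !horner_algM hornerC.
  (* Evaluating [phi (psi t) = t] at 0 yields [l = 0]. *)
  rewrite psil; congr (_ *: _); apply/eqP; have := kalg_hom_evalE (psi 'X) hphi phik.
  rewrite psiK hornerX psil (kalg_hom_alg _ hphi) hornerC => /esym/eqP.
  by rewrite scale0r scaler_eq0 oner_eq0 orbF.
have [f fE] := kalg_hom_eval 0 hphi; have [g gE] := kalg_hom_eval k hpsi.
exists f, g; split=> a.
  by rewrite gE fE -(kalg_hom_evalE _ hpsi psik) phiK hornerC.
by rewrite fE gE -(kalg_hom_evalE _ hphi phik) psiK hornerC.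
Qed.

Lemma poly_hom_ex (A C : algType K) (f : {lrmorphism A -> C}) (a b : K) :
  exists F : {poly A} -> {poly C}, [/\ kalg_hom F, forall c, F c%:P = (f c)%:P
    & F 'X = a%:A *: 'X + b%:A%:P].
Proof.
pose u : {poly C} := a%:A *: 'X + b%:A%:P.
pose h : {rmorphism A -> {poly C}} := [the {rmorphism _ -> _} of polyC \o f].
have hu : commr_rmorph h u.
  move=> c; rewrite /GRing.comm /= mulrDl mulrDr -!polyCM alg_comm; congr (_ + _).
  by rewrite -mul_polyC -mulrA -commr_polyX !mulrA -!polyCM alg_comm.
exists (horner_morph hu); split.
- split=> [p r|p r||k p]; rewrite ?rmorphD ?rmorphM ?rmorph1 //=.
  by rewrite horner_morphC /= linearZ rmorph1.
- by move=> c; rewrite horner_morphC.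
- by rewrite horner_morphX.
Qed.

Lemma poly_iso_ex (A C : algType K) (f : {lrmorphism A -> C}) (g : {lrmorphism C -> A})
    (a b : K) : cancel f g -> cancel g f -> a != 0 ->
  exists F : {poly A} -> {poly C}, [/\ kalg_iso F, forall c, F c%:P = (f c)%:P
    & F 'X = a%:A *: 'X + b%:A%:P].
Proof.
move=> fK gK a0; have [F [hF FC FX]] := poly_hom_ex f a b.
(* The inverse substitution sends [t] to [a^-1 (t - b)]. *)
have [H [hH HC HX]] := poly_hom_ex g a^-1 (- (a^-1 * b)).
exists F; split=> //; split=> //; exists H.
  elim/poly_ind => [|p c IH].
    by have [FD _ _ _] := hF; rewrite -polyC0 FC HC !rmorph0.
  have [FD FM _ _] := hF; have [HD HM _ _] := hH.
  rewrite FD FM HD HM IH FC HC fK FX HD -mul_polyC HM HX !(kalg_hom_alg _ hH).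
  congr (_ * _ + _); rewrite -mul_polyC mulrDr mulrA -!polyCM !mulr_algl !scalerA.
  by rewrite mulfV // mulrN mulrA mulfV // mul1r scaleNr polyCN subrK scale1r mul1r.
elim/poly_ind => [|p c IH].
  by have [FD _ _ _] := hF; rewrite -polyC0 HC FC !rmorph0.
have [FD FM _ _] := hF; have [HD HM _ _] := hH.
rewrite HD HM FD FM IH HC FC gK HX FD -mul_polyC FM FX !(kalg_hom_alg _ hF).
congr (_ * _ + _); rewrite -mul_polyC mulrDr mulrA -!polyCM !mulr_algl !scalerA.
by rewrite mulVf // scaleNr polyCN addrK scale1r mul1r.
Qed.

End PolynomialHomomorphisms.

(** Over the natural numbers nothing cancels, so invertible matrices are permutation matrices. The
    positive entry of [s] in the conclusion later shows that the maps obtained from [r] and from [s]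
    are inverse to each other. *)
Lemma nat_matrix_unit (n m : nat) (r : 'I_n -> 'I_m -> nat) (s : 'I_m -> 'I_n -> nat) :
    (forall i k, (\sum_j r i j * s j k)%N = (i == k)) ->
    (forall j k, (\sum_i s j i * r i k)%N = (j == k)) ->
  exists sg : 'I_n -> 'I_m, forall i, (0 < s (sg i) i)%N /\ forall j, r i j = (j == sg i).
Proof.
move=> rs sr.
have [i|sg sgP] := @choice _ _ (fun i j => (0 < r i j * s j i)%N).
  apply/existsP; have := rs i i; rewrite eqxx.
  apply: contra_eqT => /existsPn r0; rewrite big1 // => j _.
  by apply/eqP; rewrite -leqn0 leqNgt r0.
exists sg => i; have := sgP i; rewrite muln_gt0 => /andP[ri si]; split=> // j.
have := rs i i; rewrite eqxx (bigD1 (sg i)) //= => rs1.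
have [->|jsg] := eqVneq j (sg i).
  move: rs1 ri si; case: (r i _) => [//|[//|k]] + _; case: (s _ i) => [//|l].
  by rewrite mulSn mulSn addSn addnS !addSn.
have [//|rij] := posnP (r i j).
(* A second positive term would push the diagonal sum beyond 1. To produce it, row [j] of [s] has a
   nonzero entry, and if this were in a column [k] other than [i], the entry of the product at [i],
   [k] would be positive. *)
suff sji : (0 < s j i)%N.
  move: rs1; rewrite (bigD1 j) //= => rs1.
  have : (0 < r i j * s j i)%N by rewrite muln_gt0 rij.
  move: rs1 (sgP i); do 2!case: (_ * _)%N => [//|?].
  by rewrite addSn addnS.
have [k sjk] : exists k, (0 < s j k)%N.
  apply/existsP; have := sr j j; rewrite eqxx.
  apply: contra_eqT => /existsPn s0; rewrite big1 // => k _.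
  by have := s0 k; rewrite lt0n negbK => /eqP ->.
have [<- //|ik] := eqVneq k i.
have := rs i k; rewrite eq_sym (negPf ik) => /eqP; rewrite sum_nat_eq0.
by move=> /forallP/(_ j); rewrite implyTb muln_eq0 !eqn0Ngt rij sjk.
Qed.

(** * Exponents of the images of the z's under an isomorphism *)

Section Isomorphism.
Variable K : fieldType.
Variables (n : nat) (q : 'I_n -> K) (L : 'M[K]_n).
Hypothesis qp : qparams q L.
Hypothesis q_nr : forall i, not_root_of_unity (q i).
Variables (A : algType K) (x y : 'I_n -> A).
Hypothesis qwA : is_qweyl q L x y.
Variables (m : nat) (q' : 'I_m -> K) (L' : 'M[K]_m).
Hypothesis qp' : qparams q' L'.
Hypothesis q_nr' : forall i, not_root_of_unity (q' i).
Variables (C : algType K) (x' y' : 'I_m -> C).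
Hypothesis qwC : is_qweyl q' L' x' y'.
Variables (f : {lrmorphism A -> C}) (g : {lrmorphism C -> A}).
Hypotheses (fK : cancel f g) (gK : cancel g f).

Local Notation I' := ('I_m + 'I_m)%type.
Local Notation G' := {ffun I' -> int}.
Local Notation tmono' := (tmono q' L').
Local Notation tchi' := (tchi q' L').
Implicit Types h : G'.
Let chiDl := tchiDl qp'.
Let chiDr := tchiDr qp'.
Let chi_neq0 := tchi_neq0 qp'.

Lemma qgen_neq0 i : [/\ x i != 0, y i != 0 & qz x y i != 0].
Proof.
have [rho rhoE] := torus_hom qp q_nr qwA; have [rx ry] := rhoE i.
have rz := rho_qz qp q_nr rhoE i.
have m0 d : tmono q L d != 0 by apply: mono_neq0 (tchiDl qp) (tchi_neq0 qp) d.
have z0 : qz x y i != 0.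
  by apply: contra_neq (m0 (axis (inl i) 1)) => z0; rewrite -[LHS]rz z0 rmorph0.
split=> //.
  by apply: contra_neq z0 => x0; rewrite /qz x0 mul0r mulr0 subrr.
by apply: contra_neq z0 => y0; rewrite /qz y0 mul0r mulr0 subrr.
Qed.

Lemma qz_image : exists (c : 'I_n -> K) (r : 'I_n -> 'I_m -> nat),
  forall i, c i != 0 /\ f (qz x y i) = c i *: qzmon x' y' (r i).
Proof.
have [rho rhoE] := torus_hom qp' q_nr' qwC.
have [i|cr crP] := @choice _ _ (fun i (cr : K * ('I_m -> nat)) =>
    cr.1 != 0 /\ f (qz x y i) = cr.1 *: qzmon x' y' cr.2); last first.
  by exists (fun i => (cr i).1), (fun i => (cr i).2).
have [||c [r cr]] := normal_qzmon qp' q_nr' qwC rhoE (u := f (qz x y i)).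
- apply: contraTneq isT => /(congr1 g); rewrite fK rmorph0 => z0.
  by have [_ _] := qgen_neq0 i; rewrite z0 eqxx.
- move=> a; have [b zb] := qz_normal qp qwA i (g a); exists (f b).
  by rewrite -{1}[a]gK -!rmorphM zb.
by exists (c, r).
Qed.

Variable rho : {lrmorphism C -> endo K G'}.
Hypothesis rhoE : forall i, rho (x' i) = tX q' L' i /\ rho (y' i) = tY q' L' i.
Let rfin := rho_finite qp' qwC rhoE.

Lemma rho_image_qzmon (c : 'I_n -> K) (r : 'I_n -> 'I_m -> nat) (s : 'I_n -> nat) :
    (forall i, f (qz x y i) = c i *: qzmon x' y' (r i)) ->
  exists d, rho (f (qzmon x y s)) = d *: tmono' (\sum_i zdeg (r i) *+ s i).
Proof.
move=> fz; rewrite /qzmon !rmorph_prod; suff prodE : forall t : seq 'I_n,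
    (exists d, \prod_(i <- t) rho (f (qz x y i ^+ s i)) =
      d *: tmono' (\sum_(i <- t) zdeg (r i) *+ s i))
    by have [d dE] := prodE (index_enum 'I_n); exists d.
elim=> [|i t [d IH]]; first by exists 1; rewrite !big_nil (tmono0 qp') scale1r.
exists (c i ^+ s i * d); rewrite !big_cons IH !rmorphXn /= fz linearZ /=.
rewrite (rho_qzmon qp' q_nr' rhoE) exprZn (tmonoX0 qp') => [|j]; last by rewrite zdeg_inr.
rewrite -scalerAl -scalerAr (tmonoM0 qp') ?scalerA // => j.
by rewrite ffunMnE zdeg_inr mul0rn.
Qed.

(** Applying [f] after [g] to a z' multiplies the exponent matrices and returns that z'; in the
    torus the equality of two monomials, up to a scalar, forces equality of exponents. *)
Lemma qz_image_degree (c : 'I_n -> K) (r : 'I_n -> 'I_m -> nat)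
    (d : 'I_m -> K) (s : 'I_m -> 'I_n -> nat) :
    (forall i, f (qz x y i) = c i *: qzmon x' y' (r i)) ->
    (forall j, g (qz x' y' j) = d j *: qzmon x y (s j)) ->
  forall j k, (\sum_i s j i * r i k)%N = (j == k).
Proof.
move=> fz gz j k; have := rho_qz qp' q_nr' rhoE j.
rewrite -[qz x' y' j]gK gz linearZ /= linearZ /=.
have [e ->] := rho_image_qzmon (s j) fz => /esym tz.
suff /ffunP/(_ (inl k)) : \sum_i zdeg (r i) *+ s j i = axis (inl j) 1.
  rewrite axisE sum_ffunE => /(congr1 absz); rewrite (_ : (inl k == inl j) = (k == j)) //.
  rewrite eq_sym (eq_bigr (fun i => (s j i * r i k)%N%:R)) => [|i _]; last first.
    by rewrite ffunMnE zdeg_inl natz PoszM -mulr_natl natz.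
  by rewrite -natr_sum natz /= => ->; case: (j == k).
have := congr1 (fun t => tcoef t (axis (inl j) 1)) tz.
rewrite !tcoefZ /tZ !(tcoef_mono chiDl chi_neq0) eqxx.
by case: eqP => // _ /eqP; rewrite !mulr0 oner_eq0.
Qed.

End Isomorphism.

(** * The permutation and the lowest terms of the images of the x's *)

Section IsomorphismData.
Variable K : fieldType.
Variables (n : nat) (q : 'I_n -> K) (L : 'M[K]_n).
Hypothesis qp : qparams q L.
Hypothesis q_nr : forall i, not_root_of_unity (q i).
Variables (A : algType K) (x y : 'I_n -> A).
Hypothesis qwA : is_qweyl q L x y.
Variables (m : nat) (q' : 'I_m -> K) (L' : 'M[K]_m).
Hypothesis qp' : qparams q' L'.
Hypothesis q_nr' : forall i, not_root_of_unity (q' i).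
Variables (C : algType K) (x' y' : 'I_m -> C).
Hypothesis qwC : is_qweyl q' L' x' y'.

Lemma qz_single (r : 'I_m -> nat) k : (forall j, r j = (j == k)) ->
  qzmon x' y' r = qz x' y' k.
Proof.
move=> rk; have [rho rhoE] := torus_hom qp' q_nr' qwC.
apply: (rho_inj_eq qp' q_nr' qwC rhoE); rewrite (rho_qzmon qp' q_nr' rhoE).
rewrite (rho_qz qp' q_nr' rhoE) /tZ; congr (tmono _ _ _); apply/ffunP => -[j|j].
  by rewrite zdeg_inl rk axisE (_ : (inl j == inl k) = (j == k)) //; case: (j == k).
by rewrite zdeg_inr axisE.
Qed.

Variables (f : {lrmorphism A -> C}) (g : {lrmorphism C -> A}).
Hypotheses (fK : cancel f g) (gK : cancel g f).

Local Notation I' := ('I_m + 'I_m)%type.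
Local Notation G' := {ffun I' -> int}.
Local Notation tchi' := (tchi q' L').
Implicit Types h : G'.
Let chiDl := tchiDl qp'.
Let chiDr := tchiDr qp'.
Let chi_neq0 := tchi_neq0 qp'.

Section Image.
Variable rho : {lrmorphism C -> endo K G'}.
Hypothesis rhoE : forall i, rho (x' i) = tX q' L' i /\ rho (y' i) = tY q' L' i.
Let rfin := rho_finite qp' qwC rhoE.
Variables (sg : 'I_n -> 'I_m) (tau : 'I_m -> 'I_n) (c : 'I_n -> K).
Hypotheses (sgK : cancel sg tau) (tauK : cancel tau sg).
Hypothesis fz : forall i, c i != 0 /\ f (qz x y i) = c i *: qz x' y' (sg i).

Lemma rho_image_z i : rho (f (qz x y i)) = c i *: tZ q' L' (sg i).
Proof. by rewrite (fz i).2 linearZ /= (rho_qz qp' q_nr' rhoE). Qed.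

Lemma rho_image_neq0 a : a != 0 -> rho (f a) != 0.
Proof.
apply: contra_neq => /(rho_inj qp' q_nr' qwC rhoE) /(congr1 g).
by rewrite fK rmorph0.
Qed.

Lemma image_qcomm_z e a j : qcomm e a (qz x y j) -> qcomm e (rho (f a)) (tZ q' L' (sg j)).
Proof.
move=> /(congr1 (rho \o f)) /=; rewrite !(linearZ, rmorphM) /= rho_image_z.
rewrite -scalerAr -scalerAl scalerA mulrC -scalerA.
exact: scalerI (fz j).1 _ _.
Qed.

(* The lowest terms of the images of x_i and y_i add up to that of
   x_i y_i = (q_i z_i - 1) / (q_i - 1), which is the constant one; as exponents of
   the z'_k are nonnegative, they vanish. *)
Lemma image_x i : exists e : int,
  lead (@lexpos _) (rho (f (x i))) (axis (inr (sg i)) e) /\ q' (sg i) ^ e = q i.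
Proof.
have rel := qwA.1; have [x0 y0 _] := qgen_neq0 qp q_nr qwA i.
have [h lh] := lead_ex chiDl chi_neq0 (@lexposD I') (@lexpos_total I')
  (rfin (f (x i))) (rho_image_neq0 x0).
have [k lk] := lead_ex chiDl chi_neq0 (@lexposD I') (@lexpos_total I')
  (rfin (f (y i))) (rho_image_neq0 y0).
have lhk := leadM chiDl chiDr chi_neq0 (@lexpos0 I') (@lexposD I')
  (rfin _) (rfin _) lh lk.
have q1 : q i - 1 != 0 by rewrite subr_eq0 (q_neq1 q_nr).
have l0 : lead (@lexpos I') (rho (f (x i)) * rho (f (y i))) 0.
  have -> : rho (f (x i)) * rho (f (y i)) =
      (q i - 1)^-1 *: (q i * c i *: tZ q' L' (sg i) - tmono q' L' 0).
    apply: (scalerI q1); rewrite scalerA mulfV // scale1r (tmono0 qp').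
    rewrite -!rmorphM -!linearZ (qz_xy rel) (raddfB f) (raddfB rho) /=.
    by rewrite !rmorph1 linearZ /= linearZ /= rho_image_z scalerA.
  split=> [|j]; rewrite tcoefZ -scaleN1r tcoefD !tcoefZ !(tcoef_mono chiDl chi_neq0).
    rewrite eqxx (_ : (axis _ 1 == 0) = false) ?mulr0 ?add0r ?mulN1r ?mulrN1.
      by rewrite oppr_eq0 invr_eq0.
    apply/eqP => /ffunP/(_ (inl (sg i))); rewrite !ffunE eqxx.
    by move=> /eqP; rewrite oner_eq0.
  case: (_ =P j) => [<- _|_]; first by right; rewrite subr0 lexpos_axis.
  case: (_ =P j) => [<- _|_]; first by left.
  by rewrite !mulr0 addr0 mulr0 eqxx.
have hk : h + k = 0 := lead_uniq (@lexpos0 I') (@lexposD I') lhk l0.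
have hz := rho_zpos qp' qwC rhoE lh.1; have kz := rho_zpos qp' qwC rhoE lk.1.
exists (h (inr (sg i))); split; last first.
  exact: (tsupp_z qp' (rfin _) (image_qcomm_z (qcomm_xz_diag rel i)) lh.1).
suff <- : h = axis (inr (sg i)) (h (inr (sg i))) by [].
apply/ffunP => -[j|j]; rewrite axisE.
  have /ffunP/(_ (inl j)) := hk; rewrite !ffunE => /eqP.
  by rewrite paddr_eq0 ?hz ?kz // => /andP[/eqP].
rewrite (_ : (inr j == inr (sg i)) = (j == sg i)) //; case: eqVneq => [->//|ji].
(* For [j] other than [sg i], [z'_j] is up to a scalar the image of a z that commutes with [x_i], so
   the exponent of [x'_j] is zero. *)
have itj : i != tau j by apply: contra_neq ji => ->; rewrite tauK.
have := tsupp_z qp' (rfin _) (image_qcomm_z (qcomm_xz qp rel itj)) lh.1.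
by rewrite tauK => /(q_exp_eq1 q_nr').
Qed.

End Image.

Lemma qz_matching : exists (sg : 'I_n -> 'I_m) (tau : 'I_m -> 'I_n)
    (c : 'I_n -> K),
  [/\ cancel sg tau, cancel tau sg &
      forall i, c i != 0 /\ f (qz x y i) = c i *: qz x' y' (sg i)].
Proof.
have [rA rAE] := torus_hom qp q_nr qwA; have [rC rCE] := torus_hom qp' q_nr' qwC.
have [c [r fz]] := qz_image qp q_nr qwA qp' q_nr' qwC fK gK.
have [d [s gz]] := qz_image qp' q_nr' qwC qp q_nr qwA gK fK.
have sr := qz_image_degree qp' q_nr' gK rCE (fun i => (fz i).2) (fun j => (gz j).2).
have rs := qz_image_degree qp q_nr fK rAE (fun j => (gz j).2) (fun i => (fz i).2).
have [sg sgP] := nat_matrix_unit rs sr; have [tau tauP] := nat_matrix_unit sr rs.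
exists sg, tau, c; split=> [i|j|i].
(* The entry [s (sg i) i] is positive, and row [sg i] of [s] has its only nonzero entry at
   [tau (sg i)]. *)
- by have [+ _] := sgP i; rewrite (tauP _).2; case: eqP.
- by have [+ _] := tauP j; rewrite (sgP _).2; case: eqP.
by have [c0 ->] := fz i; split=> //; rewrite (qz_single (sgP i).2).
Qed.

End IsomorphismData.

Lemma intM_eq1 (a b : int) : a * b = 1 -> a = 1 \/ a = -1.
Proof.
move/(congr1 absz); rewrite abszM => /eqP; rewrite muln_eq1 => /andP[/eqP + _].
by case: a => [[|[|k]]|[|k]] //= _; [left | right].
Qed.

Lemma iso_data_of_iso (K : fieldType)
    (n : nat) (q : 'I_n -> K) (L : 'M[K]_n) (A : algType K) (x y : 'I_n -> A)
    (m : nat) (q' : 'I_m -> K) (L' : 'M[K]_m) (C : algType K) (x' y' : 'I_m -> C)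
    (f : {lrmorphism A -> C}) (g : {lrmorphism C -> A}) :
    qparams q L -> (forall i, not_root_of_unity (q i)) -> is_qweyl q L x y ->
    qparams q' L' -> (forall i, not_root_of_unity (q' i)) -> is_qweyl q' L' x' y' ->
    cancel f g -> cancel g f ->
  exists P1 sigma, iso_data q L q' L' P1 sigma.
Proof.
move=> qp q_nr qwA qp' q_nr' qwC fK gK.
have [rA rAE] := torus_hom qp q_nr qwA; have [rC rCE] := torus_hom qp' q_nr' qwC.
have [sg [tau [c [sgK tauK fz]]]] := qz_matching qp q_nr qwA qp' q_nr' qwC fK gK.
have gz j : (c (tau j))^-1 != 0 /\
    g (qz x' y' j) = (c (tau j))^-1 *: qz x y (tau j).
  have [c0 fzj] := fz (tau j); split; first by rewrite invr_neq0.
  apply: (can_inj fK); rewrite gK linearZ /= fzj tauK scalerA mulVf //.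
  by rewrite scale1r.
have [e eP] := choice (image_x qp q_nr qwA qp' q_nr' qwC fK rCE tauK fz).
(* The inverse isomorphism gives [d] with [q_i ^ d = q'_(sg i)]. Hence
   [q'_(sg i) ^ (e i * d) = q'_(sg i)], and since this is no root of unity, [e i * d = 1]. *)
have e1 i : e i = 1 \/ e i = -1.
  have [d [_ qd]] := image_x qp' q_nr' qwC qp q_nr qwA gK rAE sgK gz (sg i).
  have [_ qe] := eP i; rewrite sgK -qe exprz_exp in qd.
  by apply: (@intM_eq1 _ d); apply: (q_exp_inj qp' q_nr' (i := sg i)); rewrite expr1z.
(* Compare the lowest terms of the images of [x_i x_j] and of [L i j] times [x_j x_i]: their own
   coefficients cancel, and the ratio of the two values of [tchi'] is a power of [L']. *)
have LE i j : i != j -> L' (sg i) (sg j) ^ (e i * e j) = L i j.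
  move=> ij; have [rxx _ _ _] := (qweyl_relsP qp x y).1 qwA.1.
  have ssij : sg i != sg j by rewrite (can_eq sgK).
  have := congr1 (rC \o f) (rxx _ _ ij); rewrite /= !(linearZ, rmorphM) /=.
  have [li _] := eP i; have [lj _] := eP j.
  have fin a := rho_finite qp' qwC rCE (f a).
  have cM := tcoefM_lead (tchiDl qp') (tchiDr qp') (tchi_neq0 qp')
    (@lexpos0 ('I_m + 'I_m)%type) (@lexposD ('I_m + 'I_m)%type).
  move=> /(congr1 (fun t => tcoef t (axis (inr (sg i)) (e i) + axis (inr (sg j)) (e j)))).
  rewrite tcoefZ (cM _ _ _ _ (fin _) (fin _) li lj) addrC.
  rewrite (cM _ _ _ _ (fin _) (fin _) lj li) [tcoef (rC (f (x j))) _ * _]mulrC.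
  rewrite mulrCA => /(mulfI (mulf_neq0 li.1 lj.1)); rewrite /tchi !bichar_axis => M_E.
  rewrite -(torus_matrix_rr qp' ssij) expfzMl M_E [e j * e i]mulrC.
  rewrite -mulrA -expfzMl mulfV ?exp1rz ?mulr1 //.
  exact: torus_matrix_neq0 qp' _ _.
(* The exponent -1 occurs when [x_i] goes to a multiple of [y'], whose lowest term is a multiple of
   the inverse of [x']. *)
exists [set i | e i == 1], sg; split.
- by exists tau.
- by move=> i; rewrite inE => /eqP ei; have [_ <-] := eP i; rewrite ei expr1z.
- move=> i; rewrite inE => ei; have [_ <-] := eP i.
  by case: (e1 i) ei => -> // _; rewrite exprN1 invrK.
- move=> i j; rewrite !inE; have [->|ij] := eqVneq i j.
    by rewrite (qparam_diag qp) (qparam_diag qp').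
  by rewrite -(LE i j ij); case: (e1 i) => ->; case: (e1 j) => ->; rewrite ?expr1z.
- move=> i j; rewrite !inE; have [->|ij] := eqVneq i j; first by move=> ->.
  rewrite -(LE i j ij) => /eqP ->; case: (e1 j) => -> // _.
  by rewrite mul1r exprN1 (qparamV qp').
Qed.

Lemma qweyl_hom_cancel (K : fieldType) (n : nat) (q : 'I_n -> K) (L : 'M[K]_n)
    (A C : algType K) (x y : 'I_n -> A) (f : {lrmorphism A -> C}) (g : {lrmorphism C -> A}) :
    is_qweyl q L x y -> (forall i, g (f (x i)) = x i) -> (forall i, g (f (y i)) = y i) ->
  cancel f g.
Proof.
move=> qwA gx gy.
apply: (qweyl_ind qwA) => [|a b fa fb|c a fa|a b fa fb|i|i] //.
- by rewrite !rmorph1.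
- by rewrite !rmorphD /= fa fb.
- by rewrite !linearZ /= fa.
- by rewrite !rmorphM /= fa fb.
Qed.

(** * The explicit isomorphisms *)

Section ExplicitIsomorphism.
Variable K : fieldType.

Lemma iso_data_sym (n m : nat) (q : 'I_n -> K) (L : 'M[K]_n) (q' : 'I_m -> K)
    (L' : 'M[K]_m) P1 sigma tau :
    qparams q L -> qparams q' L' ->
    cancel sigma tau -> cancel tau sigma -> iso_data q L q' L' P1 sigma ->
  iso_data q' L' q L [set j | tau j \in P1] tau.
Proof.
move=> qp qp' sK tK [_ q1 q2 L1 L2]; split.
- by exists sigma.
- by move=> j; rewrite inE => /q1; rewrite tK.
- by move=> j; rewrite inE => /q2; rewrite tK => ->; rewrite invrK.
- by move=> i j; rewrite !inE => /L1; rewrite !tK.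
- move=> i j; rewrite !inE => iP jP; have := L2 _ _ iP jP; rewrite !tK => E.
  by rewrite -(qparamV qp) -E (qparamV qp').
Qed.

Lemma iso_data_hom (n : nat) (q : 'I_n -> K) (L : 'M[K]_n) (A : algType K)
    (x y : 'I_n -> A) (m : nat) (q' : 'I_m -> K) (L' : 'M[K]_m) (C : algType K)
    (x' y' : 'I_m -> C) P1 sigma (alpha : 'I_n -> K) :
    qparams q L -> is_qweyl q L x y -> qparams q' L' -> qweyl_rels q' L' x' y' ->
    iso_data q L q' L' P1 sigma -> (forall i, alpha i != 0) ->
  exists f : {lrmorphism A -> C}, forall i,
    f (x i) = alpha i *: (if i \in P1 then x' (sigma i) else y' (sigma i)) /\
    f (y i) = if i \in P1 then (alpha i)^-1 *: y' (sigma i)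
              else (- (q i)^-1 * (alpha i)^-1) *: x' (sigma i).
Proof.
move=> qp [_ univ] qp' rel' [[tau sK tK] q1 q2 L1 L2] a0.
pose u i := alpha i *: (if i \in P1 then x' (sigma i) else y' (sigma i)).
pose v i := if i \in P1 then (alpha i)^-1 *: y' (sigma i)
            else (- (q i)^-1 * (alpha i)^-1) *: x' (sigma i).
apply: (univ C u v _).1; apply/(qweyl_relsP qp).
have [xx yy xy r2] := (qweyl_relsP qp' x' y').1 rel'.
have yx i j : i != j -> qcomm (L' j i) (y' i) (x' j).
  move=> ij; rewrite -(qparamV qp'); apply: qcomm_sym; first exact: qparam_neq0 qp' _ _.
  by apply: xy; rewrite eq_sym.
(* Across the two parts the scalar gets inverted; the mixed case with [i] in [P1] follows from the
   stated one by inverting both matrices. *)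
have LE i j : L' (sigma i) (sigma j) = if (i \in P1) == (j \in P1) then L i j else L j i.
  case: eqP => [/L1 //|]; case iP: (i \in P1); case jP: (j \in P1) => // _.
    by rewrite -(qparamV qp') (L2 i j) ?jP // (qparamV qp).
  by rewrite (L2 j i) ?iP.
have sij i j : i != j -> sigma i != sigma j by rewrite (can_eq sK).
split=> [i j ij|i j ij|i j ij|i]; rewrite /u /v.
- have ss := sij _ _ ij; apply/qcommZ/qcommZl.
  have := LE i j; have := LE j i; rewrite [(j \in P1) == _]eq_sym.
  case: (i \in P1); case: (j \in P1) => /= Lji Lij; rewrite -?Lij -?Lji;
    by [apply: xx | apply: yy | apply: xy | apply: yx].
- have ss := sij _ _ ij.
  have := LE i j; have := LE j i; rewrite [(j \in P1) == _]eq_sym.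
  case: (i \in P1); case: (j \in P1) => /= Lji Lij; apply/qcommZ/qcommZl; rewrite -?Lij -?Lji;
    by [apply: xx | apply: yy | apply: xy | apply: yx].
- have ss := sij _ _ ij.
  have := LE i j; have := LE j i; rewrite [(j \in P1) == _]eq_sym.
  case: (i \in P1); case: (j \in P1) => /= Lji Lij; apply/qcommZ/qcommZl; rewrite -?Lij -?Lji;
    by [apply: xx | apply: yy | apply: xy | apply: yx].
have q0 := qparam_q_neq0 qp i.
case: ifP => [iP|/negbT iP]; rewrite -!scalerAl -!scalerAr !scalerA.
  by rewrite mulfV // divfK // scale1r -(q1 i iP); apply: r2.
rewrite mulrC divfK // -mulrA divfK // mulrN mulfV // scaleN1r opprK addrC.
by rewrite scaleNr -(q2 i iP); apply: r2.
Qed.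

Lemma iso_data_iso (n : nat) (q : 'I_n -> K) (L : 'M[K]_n) (A : algType K)
    (x y : 'I_n -> A) (m : nat) (q' : 'I_m -> K) (L' : 'M[K]_m) (C : algType K)
    (x' y' : 'I_m -> C) P1 sigma (alpha : 'I_n -> K) :
    qparams q L -> is_qweyl q L x y -> qparams q' L' -> is_qweyl q' L' x' y' ->
    iso_data q L q' L' P1 sigma -> (forall i, alpha i != 0) ->
  exists (f : {lrmorphism A -> C}) (g : {lrmorphism C -> A}),
  [/\ cancel f g, cancel g f & forall i,
    f (x i) = alpha i *: (if i \in P1 then x' (sigma i) else y' (sigma i)) /\
    f (y i) = if i \in P1 then (alpha i)^-1 *: y' (sigma i)
              else (- (q i)^-1 * (alpha i)^-1) *: x' (sigma i)].
Proof.
move=> qp qwA qp' qwC dat a0; have q0 := qparam_q_neq0 qp.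
have [f fE] := iso_data_hom qp qwA qp' qwC.1 dat a0.
have [[tau sK tK] q1 q2 _ _] := dat.
(* Obtained by solving the formulas of [f] for [x']: on [P1] it is the image of [x_i] divided by
   [alpha i], elsewhere the image of [y_i] multiplied by [- q i * alpha i]. *)
pose beta j := if tau j \in P1 then (alpha (tau j))^-1 else - q (tau j) * alpha (tau j).
have b0 j : beta j != 0.
  by rewrite /beta; case: ifP; rewrite ?invr_neq0 // mulf_neq0 // oppr_eq0.
have [g gE] := iso_data_hom qp' qwC qp qwA.1 (iso_data_sym qp qp' sK tK dat) b0.
have ba i : alpha i * (- q i * (- q i * alpha i)^-1) = 1.
  by rewrite invfM [- q i * (_ * _)]mulrA mulfV ?oppr_eq0 // mul1r mulfV.
have ab i : - (q i)^-1 * (alpha i)^-1 * (- q i * alpha i) = 1.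
  by rewrite mulrACA mulrNN !mulVf // mulr1.
have bE i : beta (sigma i) = if i \in P1 then (alpha i)^-1 else - q i * alpha i.
  by rewrite /beta sK.
have gE' i : g (x' (sigma i)) = beta (sigma i) *: (if i \in P1 then x i else y i) /\
    g (y' (sigma i)) = if i \in P1 then (beta (sigma i))^-1 *: y i
      else (- q i * (beta (sigma i))^-1) *: x i.
  have := gE (sigma i); rewrite inE sK => -[-> ->]; split=> //.
  by case: ifP => // /negbT iP; rewrite (q2 i iP) invrK.
exists f, g; split=> //.
  apply: (qweyl_hom_cancel qwA) => i.
    have [-> _] := fE i; have [gx gy] := gE' i; move: gx gy; rewrite bE linearZ /=.
    case: ifP => [iP -> _|/negbT iP _ ->]; rewrite scalerA ?mulfV ?scale1r //.
    by rewrite ba // scale1r.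
  have [_ ->] := fE i; have [gx gy] := gE' i; move: gx gy; rewrite bE.
  case: ifP => [iP _ gy|/negbT iP gx _]; rewrite linearZ /=.
    by rewrite gy scalerA invrK mulVf // scale1r.
  by rewrite gx scalerA ab scale1r.
apply: (qweyl_hom_cancel qwC) => j; rewrite -(tK j); move: (tau j) => {j} i.
  have [-> _] := gE' i; have [fx fy] := fE i; move: fx fy; rewrite bE linearZ /=.
  case: ifP => [iP -> _|/negbT iP _ ->]; rewrite scalerA ?mulVf ?scale1r //.
  by rewrite mulrC ab scale1r.
have [_ ->] := gE' i; have [fx fy] := fE i; move: fx fy; rewrite bE.
case: ifP => [iP _ fy|/negbT iP fx _]; rewrite linearZ /=.
  by rewrite fy scalerA invrK mulfV // scale1r.
by rewrite fx scalerA mulrC ba // scale1r.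
Qed.

End ExplicitIsomorphism.

Theorem theorem2p6 (K : fieldType) (n m : nat)
    (q : 'I_n -> K) (L : 'M[K]_n) (q' : 'I_m -> K) (L' : 'M[K]_m)
    (A : algType K) (x y : 'I_n -> A) (C : algType K) (x' y' : 'I_m -> C) :
  (0 < n)%N -> (0 < m)%N ->
  qparams q L -> qparams q' L' ->
  (forall i, not_root_of_unity (q i)) -> (forall i, not_root_of_unity (q' i)) ->
  is_qweyl q L x y -> is_qweyl q' L' x' y' ->
  ((exists phi : {poly A} -> {poly C}, kalg_iso phi) <->
     (m = n /\ exists (P1 : {set 'I_n}) (sigma : 'I_n -> 'I_m),
                 iso_data q L q' L' P1 sigma))
  /\
  (forall (P1 : {set 'I_n}) (sigma : 'I_n -> 'I_m),
     iso_data q L q' L' P1 sigma ->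
     forall (alpha : 'I_n -> K) (a b : K),
       (forall i, alpha i != 0) -> a != 0 ->
       exists phi : {poly A} -> {poly C},
         [/\ kalg_iso phi,
             forall i, i \in P1 ->
               phi (x i)%:P = (alpha i *: x' (sigma i))%:P /\
               phi (y i)%:P = ((alpha i)^-1 *: y' (sigma i))%:P,
             forall i, i \notin P1 ->
               phi (x i)%:P = (alpha i *: y' (sigma i))%:P /\
               phi (y i)%:P = ((- (q i)^-1 * (alpha i)^-1) *: x' (sigma i))%:P
           & phi 'X = (a *: (1 : C)) *: 'X + (b *: (1 : C))%:P]).
Proof.
move=> _ _ qp qp' q_nr q_nr' qwA qwC.
have explicit P1 sigma : iso_data q L q' L' P1 sigma -> forall alpha a b,
    (forall i, alpha i != 0) -> a != 0 -> exists phi : {poly A} -> {poly C},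
    [/\ kalg_iso phi,
        forall i, i \in P1 ->
          phi (x i)%:P = (alpha i *: x' (sigma i))%:P /\
          phi (y i)%:P = ((alpha i)^-1 *: y' (sigma i))%:P,
        forall i, i \notin P1 ->
          phi (x i)%:P = (alpha i *: y' (sigma i))%:P /\
          phi (y i)%:P = ((- (q i)^-1 * (alpha i)^-1) *: x' (sigma i))%:P
      & phi 'X = (a *: (1 : C)) *: 'X + (b *: (1 : C))%:P].
  move=> dat alpha a b alpha0 a0.
  have [f [g [fK gK fE]]] := iso_data_iso qp qwA qp' qwC dat alpha0.
  have [phi [phi_iso phiC phiX]] := poly_iso_ex b fK gK a0.
  exists phi; split=> // i iP; have [fx fy] := fE i; rewrite !phiC fx fy.
    by rewrite iP.
  by rewrite (negPf iP).
split=> //; split=> [[phi phi_iso]|[_ [P1 [sigma dat]]]].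
  have [rA rAE] := torus_hom qp q_nr qwA; have [rC rCE] := torus_hom qp' q_nr' qwC.
  have [f [g [fK gK]]] := poly_cancellation (qweyl_center qp q_nr qwA rAE)
    (qweyl_center qp' q_nr' qwC rCE) phi_iso.
  have [P1 [sigma dat]] := iso_data_of_iso qp q_nr qwA qp' q_nr' qwC fK gK.
  split; last by exists P1, sigma.
  by have [/bij_eq_card + _ _ _ _] := dat; rewrite !card_ord.
have [|phi [phi_iso _ _ _]] := explicit _ _ dat (fun=> 1) 1 0 _ (oner_neq0 K).
  by move=> i; apply: oner_neq0.
by exists phi.
Qed.
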